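(* Let $\lambda$ be a real algebraic irrational number, i.e. $\lambda\in(\overline{\mathbb Q}\cap\mathbb R)\setminus\mathbb Q$. Then the Lie group $G_\lambda$ admits a uniform model set, but does not admit any lattice.
   Context: For $\lambda\in\mathbb R\setminus\{0,1\}$ let $\mathfrak g_\lambda$ be the 7-dimensional nilpotent real Lie algebra with basis $X_1,\dots,X_7$ and brackets $[X_1,X_i]=X_{i+1}$ for $2\le i\le 6$, $[X_2,X_3]=X_5$, $[X_2,X_4]=X_6$, $[X_2,X_5]=\lambda X_7$, $[X_3,X_4]=(1-\lambda)X_7$, all brackets not determined by these being $0$. $G_\lambda$ denotes the unique simply-connected Lie group with Lie algebra $\mathfrak g_\lambda$. A lattice in a locally compact second countable (lcsc) group $G$ is a discrete subgroup $\Gamma$ such that $G/\Gamma$ admits a $G$-invariant probability measure; it is uniform if $G/\Gamma$ is compact. A uniform cut-and-project scheme is a triple $(G,H,\Gamma)$ where $G,H$ are lcsc groups and $\Gamma<G\times H$ is a uniform lattice such that the coordinate projection $\pi_G$ is injective on $\Gamma$ and $\pi_H(\Gamma)$ is dense in $H$. A uniform model set in $G$ is a set of the form $\pi_G((G\times W_0)\cap\Gamma)$ where $(G,H,\Gamma)$ is a uniform cut-and-project scheme and $W_0\subset H$ is a compact subset with non-empty interior. *)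

(* Defs.v *)
From HB Require Import structures.
From mathcomp Require Import all_boot all_order all_algebra.
From mathcomp Require Import all_classical all_reals all_analysis.
From mathcomp Require Import ring.

Set Implicit Arguments.
Unset Strict Implicit.
Unset Printing Implicit Defensive.

Import Order.TTheory GRing.Theory Num.Theory numFieldNormedType.Exports.

Local Open Scope classical_set_scope.
Local Open Scope ring_scope.

HB.mixin Record isTopologicalGroup G & Topological G & Group G := {
  mulg_continuous : continuous (fun p : G * G => (p.1 * p.2)%g) ;
  invg_continuous : continuous (fun x : G => x^-1%g)
}.

#[short(type="topologicalGroupType")]
HB.structure Definition TopologicalGroup :=
  {G of Topological G & Group G & isTopologicalGroup G}.

Section prod_topological_group.
Variables G H : topologicalGroupType.

Let prod_mulg_continuous :
  continuous (fun p : (G * H) * (G * H) => (p.1 * p.2)%g).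
Proof.
move=> [[x1 x2] [y1 y2]].
have c1 : (fun p : (G * H) * (G * H) => p.1) @ ((x1, x2), (y1, y2)) -->
    (x1, x2) by exact: cvg_fst.
have c2 : (fun p : (G * H) * (G * H) => p.2) @ ((x1, x2), (y1, y2)) -->
    (y1, y2) by exact: cvg_snd.
apply: cvg_pair.
  apply: (@continuous2_cvg _ _ _ _ _ _ _ _ (fun a b => a * b)%g _ _
    (@mulg_continuous G (x1, y1))).
    exact: (cvg_comp _ _ c1 cvg_fst).
  exact: (cvg_comp _ _ c2 cvg_fst).
apply: (@continuous2_cvg _ _ _ _ _ _ _ _ (fun a b => a * b)%g _ _
    (@mulg_continuous H (x2, y2))).
  exact: (cvg_comp _ _ c1 cvg_snd).
exact: (cvg_comp _ _ c2 cvg_snd).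
Qed.

Let prod_invg_continuous : continuous (fun x : G * H => x^-1%g).
Proof.
move=> [x y].
have c1 : (fun p : G * H => p.1) @ (x, y) --> x by exact: cvg_fst.
have c2 : (fun p : G * H => p.2) @ (x, y) --> y by exact: cvg_snd.
apply: cvg_pair.
  exact: (cvg_comp _ _ c1 (@invg_continuous G x)).
exact: (cvg_comp _ _ c2 (@invg_continuous H y)).
Qed.

HB.instance Definition _ :=
  isTopologicalGroup.Build (G * H)%type prod_mulg_continuous
    prod_invg_continuous.
End prod_topological_group.

(* Locally compact groups are Hausdorff by convention. *)
Definition lcsc (G : topologicalGroupType) : Prop :=
  [/\ hausdorff_space G, locally_compact [set: G] & @second_countable G].

Section coset_space.
Variables (G : topologicalGroupType) (Gamma : set G).

(* [same_coset x y] says that the left cosets x Gamma and y Gamma coincide;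
   stated this way it is an equivalence relation for any set Gamma. *)
Definition same_coset (x y : G) : bool :=
  `[< [set (x * z)%g | z in Gamma] = [set (y * z)%g | z in Gamma] >].

Let same_coset_refl : reflexive same_coset.
Proof. by move=> x; apply/asboolP. Qed.

Let same_coset_sym : symmetric same_coset.
Proof. by move=> x y; apply/asboolP/asboolP => ->. Qed.

Let same_coset_trans : transitive same_coset.
Proof. by move=> y x z /asboolP xy /asboolP yz; apply/asboolP; rewrite xy. Qed.

Definition coset_equiv : equiv_rel G :=
  EquivRel same_coset same_coset_refl same_coset_sym same_coset_trans.

Definition coset_space : Type :=
  quotient_topology {eq_quot coset_equiv}%qT.

HB.instance Definition _ := Quotient.on coset_space.
HB.instance Definition _ := Topological.on coset_space.
HB.instance Definition _ :=
  isPointed.Build coset_space ((\pi_coset_space 1%g)%qT : coset_space).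

Definition coset_act (g : G) (q : coset_space) : coset_space :=
  (\pi_coset_space (g * repr q)%g)%qT.

Lemma coset_actE (g x : G) :
  coset_act g (\pi_coset_space x)%qT = (\pi_coset_space (g * x)%g)%qT.
Proof.
have e : same_coset (repr (\pi_coset_space x)%qT) x.
  by have /eqmodP := reprK ((\pi_coset_space x)%qT : coset_space).
apply/eqmodP/asboolP; move/asboolP: e => e.
have tr y : [set (g * y * z)%g | z in Gamma] =
    [set (g * w)%g | w in [set (y * z)%g | z in Gamma]].
  by rewrite image_comp; apply: eq_imagel => z _; rewrite /= mulgA.
by rewrite !tr e.
Qed.

Definition borel_coset_space := g_sigma_algebraType (@open coset_space).

End coset_space.

Section lattices.
Variables (R : realType) (G : topologicalGroupType).
Implicit Type Gamma : set G.

Definition discrete_subgroup Gamma : Prop :=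
  group_closed [in Gamma] /\ Gamma `<=` isolated Gamma.

Definition invariant_probability Gamma
    (mu : probability (borel_coset_space Gamma) R) : Prop :=
  forall (g : G) (A : set (borel_coset_space Gamma)),
    measurable A -> mu (coset_act g @^-1` A) = mu A.

Definition lattice Gamma : Prop :=
  discrete_subgroup Gamma /\
  exists mu : probability (borel_coset_space Gamma) R,
    invariant_probability mu.

Definition uniform_lattice Gamma : Prop :=
  lattice Gamma /\ compact [set: coset_space Gamma].

End lattices.

Definition uniform_cut_and_project_scheme (R : realType)
    (G H : topologicalGroupType) (Gamma : set (G * H)%type) : Prop :=
  [/\ lcsc G, lcsc H, uniform_lattice R Gamma,
      {in Gamma &, injective (@fst G H)} & dense (@snd G H @` Gamma)].

Definition uniform_model_set (R : realType) (G : topologicalGroupType)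
    (P : set G) : Prop :=
  exists (H : topologicalGroupType) (Gamma : set (G * H)%type) (W0 : set H),
    [/\ uniform_cut_and_project_scheme R Gamma, compact W0, W0° !=set0 &
        P = @fst G H @` (([set: G] `*` W0) `&` Gamma)].

Reserved Notation "{[ x , y ]}" (at level 0, x at level 200, y at level 200,
  format "{[ x ,  y ]}").

Section bch.
Variables (R : fieldType) (V : lmodType R) (br : V -> V -> V).
Local Notation "{[ x , y ]}" := (br x y).

(* The Baker-Campbell-Hausdorff series log (exp x exp y) up to degree 6; this
   is the whole series when all brackets of length 7 vanish. *)
Definition bch6 (x y : V) : V :=
  x + y
  + 2^-1 *: {[x, y]}
  + 12^-1 *: ({[x, {[x, y]}]} + {[y, {[y, x]}]})
  - 24^-1 *: {[y, {[x, {[x, y]}]}]}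
  - 720^-1 *: ({[y, {[y, {[y, {[y, x]}]}]}]} + {[x, {[x, {[x, {[x, y]}]}]}]})
  + 360^-1 *: ({[x, {[y, {[y, {[y, x]}]}]}]} + {[y, {[x, {[x, {[x, y]}]}]}]})
  + 120^-1 *: ({[y, {[x, {[y, {[x, y]}]}]}]} + {[x, {[y, {[x, {[y, x]}]}]}]})
  + 240^-1 *: {[x, {[y, {[x, {[y, {[x, y]}]}]}]}]}
  + 720^-1 *: ({[x, {[y, {[x, {[x, {[x, y]}]}]}]}]}
               - {[x, {[x, {[y, {[y, {[x, y]}]}]}]}]})
  + 1440^-1 *: ({[x, {[y, {[y, {[y, {[x, y]}]}]}]}]}
                - {[x, {[x, {[y, {[x, {[x, y]}]}]}]}]}).

End bch.

Lemma bch6_expansion (R : realType) (n : nat)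
    (br : 'rV[R]_n -> 'rV[R]_n -> 'rV[R]_n)
    (brZl : forall k x y, br (k *: x) y = k *: br x y)
    (brZr : forall k x y, br x (k *: y) = k *: br x y) (x y : 'rV[R]_n) :
  exists c3 c4 c5 c6, forall t : R,
    bch6 br (t *: x) (t *: y) =
    t *: (x + y) + t ^+ 2 *: (2^-1 *: br x y) +
    t ^+ 3 *: (c3 + t *: c4 + t ^+ 2 *: c5 + t ^+ 3 *: c6).
Proof.
exists (12^-1 *: (br x (br x y) + br y (br y x))).
exists (- 24^-1 *: br y (br x (br x y))).
exists (- 720^-1 *: (br y (br y (br y (br y x))) + br x (br x (br x (br x y))))
  + 360^-1 *: (br x (br y (br y (br y x))) + br y (br x (br x (br x y))))
  + 120^-1 *: (br y (br x (br y (br x y))) + br x (br y (br x (br y x))))).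
exists (240^-1 *: br x (br y (br x (br y (br x y))))
  + 720^-1 *: (br x (br y (br x (br x (br x y))))
               - br x (br x (br y (br y (br x y)))))
  + 1440^-1 *: (br x (br y (br y (br y (br x y))))
                - br x (br x (br y (br x (br x y)))))) => t.
rewrite /bch6 !(brZl, brZr).
by apply/rowP => i; rewrite !mxE; field.
Qed.

Section lie_algebra.
Variables (R : realType) (lambda : R).
Local Notation V := 'rV[R]_7.

(* [basis_vec i] is X_i for 1 <= i <= 7 and is 0 otherwise. *)
Definition basis_vec (i : nat) : V := \row_(j < 7) (j.+1 == i)%:R.
Local Notation X := basis_vec.

(* [X_i, X_j] for i < j; the first clause gives [X_1, X_7] = X_8 = 0. *)
Definition basis_bracket (i j : nat) : V :=
  match i, j with
  | 1%N, _ => X j.+1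
  | 2%N, 3%N => X 5
  | 2%N, 4%N => X 6
  | 2%N, 5%N => lambda *: X 7
  | 3%N, 4%N => (1 - lambda) *: X 7
  | _, _ => 0
  end.

(* The alternating bilinear extension of [basis_bracket]. *)
Definition lie_bracket (x y : V) : V :=
  \sum_(i < 7) \sum_(j < 7 | (i < j)%N)
    (x 0 i * y 0 j - x 0 j * y 0 i) *: basis_bracket i.+1 j.+1.

Let mk (a b c d e f g : R) : V :=
  \row_i nth 0 [:: a; b; c; d; e; f; g] i.

Let mkP (x : V) : exists a b c d e f g, x = mk a b c d e f g.
Proof.
exists (x 0 (inord 0)), (x 0 (inord 1)), (x 0 (inord 2)), (x 0 (inord 3)),
  (x 0 (inord 4)), (x 0 (inord 5)), (x 0 (inord 6)).
by apply/rowP => -[[|[|[|[|[|[|[|//]]]]]]] ?]; rewrite mxE /=;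
  congr (x 0 _); apply/val_inj; rewrite /= inordK.
Qed.

Let mkD a b c d e f g a' b' c' d' e' f' g' :
  mk a b c d e f g + mk a' b' c' d' e' f' g' =
  mk (a + a') (b + b') (c + c') (d + d') (e + e') (f + f') (g + g').
Proof.
by apply/rowP => -[[|[|[|[|[|[|[|//]]]]]]] ?]; rewrite !mxE.
Qed.

Let mkN a b c d e f g : - mk a b c d e f g =
  mk (- a) (- b) (- c) (- d) (- e) (- f) (- g).
Proof. by apply/rowP => -[[|[|[|[|[|[|[|//]]]]]]] ?]; rewrite !mxE. Qed.

Let mkZ k a b c d e f g : k *: mk a b c d e f g =
  mk (k * a) (k * b) (k * c) (k * d) (k * e) (k * f) (k * g).
Proof. by apply/rowP => -[[|[|[|[|[|[|[|//]]]]]]] ?]; rewrite !mxE. Qed.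

Let XE k : X k = mk (1 == k)%:R (2 == k)%:R (3 == k)%:R (4 == k)%:R
    (5 == k)%:R (6 == k)%:R (7 == k)%:R.
Proof. by apply/rowP => -[[|[|[|[|[|[|[|//]]]]]]] ?]; rewrite !mxE. Qed.

Let mk_bracket x1 x2 x3 x4 x5 x6 x7 y1 y2 y3 y4 y5 y6 y7 :
  lie_bracket (mk x1 x2 x3 x4 x5 x6 x7) (mk y1 y2 y3 y4 y5 y6 y7) =
  mk 0 0 (x1 * y2 - x2 * y1) (x1 * y3 - x3 * y1)
     (x1 * y4 - x4 * y1 + (x2 * y3 - x3 * y2))
     (x1 * y5 - x5 * y1 + (x2 * y4 - x4 * y2))
     (x1 * y6 - x6 * y1 + lambda * (x2 * y5 - x5 * y2) +
      (1 - lambda) * (x3 * y4 - x4 * y3)).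
Proof.
rewrite /lie_bracket; under eq_bigr do rewrite big_mkcond /=.
rewrite !big_ord_recl !big_ord0 /= !(scaler0, addr0, add0r) !XE !mxE /=.
by rewrite !mkZ !mkD; congr mk; ring.
Qed.

Let mk_bch x1 x2 x3 x4 x5 x6 x7 y1 y2 y3 y4 y5 y6 y7 :
  bch6 lie_bracket (mk x1 x2 x3 x4 x5 x6 x7) (mk y1 y2 y3 y4 y5 y6 y7) =
  mk
     (x1 + y1)
     (x2 + y2)
     (x3 + y3 + 1 / 2 * (x1 * y2) - 1 / 2 * (x2 * y1))
     (x4 + y4 + 1 / 2 * (x1 * y3) - 1 / 2 * (x3 * y1) + 1 / 12 * (x1 * x1 *
      y2) - 1 / 12 * (x1 * x2 * y1) - 1 / 12 * (x1 * y1 * y2) + 1 / 12 * (x2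
      * y1 * y1))
     (x5 + y5 + 1 / 2 * (x1 * y4) + 1 / 2 * (x2 * y3) - 1 / 2 * (x3 * y2) -
      1 / 2 * (x4 * y1) + 1 / 12 * (x1 * x1 * y3) + 1 / 12 * (x1 * x2 * y2)
      - 1 / 12 * (x1 * x3 * y1) - 1 / 12 * (x1 * y1 * y3) - 1 / 12 * (x1 *
      y2 * y2) - 1 / 12 * (x2 * x2 * y1) + 1 / 12 * (x2 * y1 * y2) + 1 / 12
      * (x3 * y1 * y1) - 1 / 24 * (x1 * x1 * y1 * y2) + 1 / 24 * (x1 * x2 *
      y1 * y1))
     (x6 + y6 + 1 / 2 * (x1 * y5) + 1 / 2 * (x2 * y4) - 1 / 2 * (x4 * y2) -
      1 / 2 * (x5 * y1) + 1 / 12 * (x1 * x1 * y4) + 1 / 6 * (x1 * x2 * y3) -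
      1 / 12 * (x1 * x3 * y2) - 1 / 12 * (x1 * x4 * y1) - 1 / 12 * (x1 * y1
      * y4) - 1 / 12 * (x1 * y2 * y3) - 1 / 12 * (x2 * x3 * y1) - 1 / 12 *
      (x2 * y1 * y3) + 1 / 6 * (x3 * y1 * y2) + 1 / 12 * (x4 * y1 * y1) - 1
      / 24 * (x1 * x1 * y1 * y3) - 1 / 24 * (x1 * x1 * y2 * y2) + 1 / 24 *
      (x1 * x3 * y1 * y1) + 1 / 24 * (x2 * x2 * y1 * y1) - 1 / 720 * (x1 *
      x1 * x1 * x1 * y2) + 1 / 720 * (x1 * x1 * x1 * x2 * y1) - 1 / 180 *
      (x1 * x1 * x1 * y1 * y2) + 1 / 180 * (x1 * x1 * x2 * y1 * y1) + 1 /
      180 * (x1 * x1 * y1 * y1 * y2) - 1 / 180 * (x1 * x2 * y1 * y1 * y1) +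
      1 / 720 * (x1 * y1 * y1 * y1 * y2) - 1 / 720 * (x2 * y1 * y1 * y1 *
      y1))
     (x7 + y7 + 1 / 2 * (x1 * y6) + 1 / 2 * (x3 * y4) - 1 / 2 * (x4 * y3) -
      1 / 2 * (x6 * y1) + 1 / 2 * (lambda * x2 * y5) - 1 / 2 * (lambda * x3
      * y4) + 1 / 2 * (lambda * x4 * y3) - 1 / 2 * (lambda * x5 * y2) + 1 /
      12 * (x1 * x1 * y5) + 1 / 12 * (x1 * x2 * y4) + 1 / 12 * (x1 * x3 *
      y3) - 1 / 6 * (x1 * x4 * y2) - 1 / 12 * (x1 * x5 * y1) - 1 / 12 * (x1
      * y1 * y5) + 1 / 12 * (x1 * y2 * y4) - 1 / 12 * (x1 * y3 * y3) + 1 /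
      12 * (x2 * x4 * y1) - 1 / 6 * (x2 * y1 * y4) - 1 / 12 * (x3 * x3 * y1)
      + 1 / 12 * (x3 * y1 * y3) + 1 / 12 * (x4 * y1 * y2) + 1 / 12 * (x5 *
      y1 * y1) + 1 / 12 * (lambda * x1 * x2 * y4) - 1 / 12 * (lambda * x1 *
      x3 * y3) + 1 / 12 * (lambda * x1 * x4 * y2) - 1 / 6 * (lambda * x1 *
      y2 * y4) + 1 / 12 * (lambda * x1 * y3 * y3) + 1 / 12 * (lambda * x2 *
      x2 * y3) - 1 / 12 * (lambda * x2 * x3 * y2) - 1 / 6 * (lambda * x2 *
      x4 * y1) + 1 / 12 * (lambda * x2 * y1 * y4) - 1 / 12 * (lambda * x2 *
      y2 * y3) + 1 / 12 * (lambda * x3 * x3 * y1) - 1 / 12 * (lambda * x3 *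
      y1 * y3) + 1 / 12 * (lambda * x3 * y2 * y2) + 1 / 12 * (lambda * x4 *
      y1 * y2) - 1 / 24 * (x1 * x1 * y1 * y4) - 1 / 24 * (x1 * x1 * y2 * y3)
      - 1 / 24 * (x1 * x2 * y1 * y3) + 1 / 24 * (x1 * x3 * y1 * y2) + 1 / 24
      * (x1 * x4 * y1 * y1) + 1 / 24 * (x2 * x3 * y1 * y1) - 1 / 24 *
      (lambda * x1 * x2 * y1 * y3) - 1 / 24 * (lambda * x1 * x2 * y2 * y2) +
      1 / 24 * (lambda * x1 * x3 * y1 * y2) + 1 / 24 * (lambda * x2 * x2 *
      y1 * y2) - 1 / 720 * (x1 * x1 * x1 * x1 * y3) - 1 / 360 * (x1 * x1 *
      x1 * x2 * y2) + 1 / 720 * (x1 * x1 * x1 * x3 * y1) - 1 / 180 * (x1 *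
      x1 * x1 * y1 * y3) - 1 / 120 * (x1 * x1 * x1 * y2 * y2) + 1 / 360 *
      (x1 * x1 * x2 * x2 * y1) + 1 / 180 * (x1 * x1 * x2 * y1 * y2) + 1 /
      180 * (x1 * x1 * x3 * y1 * y1) + 1 / 180 * (x1 * x1 * y1 * y1 * y3) +
      1 / 360 * (x1 * x1 * y1 * y2 * y2) + 1 / 360 * (x1 * x2 * x2 * y1 *
      y1) + 1 / 180 * (x1 * x2 * y1 * y1 * y2) - 1 / 180 * (x1 * x3 * y1 *
      y1 * y1) + 1 / 720 * (x1 * y1 * y1 * y1 * y3) + 1 / 360 * (x1 * y1 *
      y1 * y2 * y2) - 1 / 120 * (x2 * x2 * y1 * y1 * y1) - 1 / 360 * (x2 *
      y1 * y1 * y1 * y2) - 1 / 720 * (x3 * y1 * y1 * y1 * y1) - 1 / 720 *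
      (lambda * x1 * x1 * x1 * x2 * y2) + 1 / 360 * (lambda * x1 * x1 * x1 *
      y2 * y2) + 1 / 720 * (lambda * x1 * x1 * x2 * x2 * y1) - 1 / 90 *
      (lambda * x1 * x1 * x2 * y1 * y2) + 1 / 120 * (lambda * x1 * x1 * y1 *
      y2 * y2) + 1 / 120 * (lambda * x1 * x2 * x2 * y1 * y1) - 1 / 90 *
      (lambda * x1 * x2 * y1 * y1 * y2) + 1 / 720 * (lambda * x1 * y1 * y1 *
      y2 * y2) + 1 / 360 * (lambda * x2 * x2 * y1 * y1 * y1) - 1 / 720 *
      (lambda * x2 * y1 * y1 * y1 * y2) + 1 / 1440 * (x1 * x1 * x1 * x1 * y1
      * y2) - 1 / 1440 * (x1 * x1 * x1 * x2 * y1 * y1) + 1 / 360 * (x1 * x1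
      * x1 * y1 * y1 * y2) - 1 / 360 * (x1 * x1 * x2 * y1 * y1 * y1) + 1 /
      1440 * (x1 * x1 * y1 * y1 * y1 * y2) - 1 / 1440 * (x1 * x2 * y1 * y1 *
      y1 * y1)).
Proof.
rewrite /bch6 !mk_bracket !(mkN, mkZ, mkD).
by congr mk; field.
Qed.

Lemma lie_bracketX (i j : nat) : (1 <= i)%N -> (i < j)%N -> (j <= 7)%N ->
  lie_bracket (X i) (X j) = basis_bracket i j.
Proof.
have mk0 : 0 = mk 0 0 0 0 0 0 0.
  by rewrite -(scale0r (mk 0 0 0 0 0 0 0)) mkZ mul0r.
case: i => [//|[|[|[|[|[|[|i]]]]]]] _;
  case: j => [//|[|[|[|[|[|[|[|[|j]]]]]]]]] //= _ _;
  by rewrite ?mk0 !XE /= mk_bracket ?mkZ /=; congr mk; ring.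
Qed.

Lemma lie_bracketxx x : lie_bracket x x = 0.
Proof.
have [x1 [x2 [x3 [x4 [x5 [x6 [x7 ->]]]]]]] := mkP x.
rewrite mk_bracket.
by apply/rowP => -[[|[|[|[|[|[|[|//]]]]]]] ?]; rewrite !mxE /=; ring.
Qed.

Lemma lie_bracket_jacobi x y z :
  lie_bracket x (lie_bracket y z) + lie_bracket y (lie_bracket z x) +
  lie_bracket z (lie_bracket x y) = 0.
Proof.
have [x1 [x2 [x3 [x4 [x5 [x6 [x7 ->]]]]]]] := mkP x.
have [y1 [y2 [y3 [y4 [y5 [y6 [y7 ->]]]]]]] := mkP y.
have [z1 [z2 [z3 [z4 [z5 [z6 [z7 ->]]]]]]] := mkP z.
rewrite !mk_bracket !mkD.
by apply/rowP => -[[|[|[|[|[|[|[|//]]]]]]] ?]; rewrite !mxE /=; ring.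
Qed.

Lemma lie_bracketC x y : lie_bracket y x = - lie_bracket x y.
Proof.
rewrite /lie_bracket -sumrN; apply: eq_bigr => i _; rewrite -sumrN.
by apply: eq_bigr => j _; rewrite -[RHS]scaleNr opprB mulrC [y 0 j * _]mulrC.
Qed.

Lemma lie_bracketZl k x y : lie_bracket (k *: x) y = k *: lie_bracket x y.
Proof.
rewrite /lie_bracket scaler_sumr; apply: eq_bigr => i _; rewrite scaler_sumr.
by apply: eq_bigr => j _; rewrite !mxE -!mulrA -mulrBr scalerA.
Qed.

Lemma lie_bracketZr k x y : lie_bracket x (k *: y) = k *: lie_bracket x y.
Proof. by rewrite lie_bracketC lie_bracketZl lie_bracketC scalerN opprK. Qed.

Local Notation BCH := (bch6 lie_bracket).

Lemma BCHA : associative BCH.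
Proof.
move=> x y z.
have [x1 [x2 [x3 [x4 [x5 [x6 [x7 ->]]]]]]] := mkP x.
have [y1 [y2 [y3 [y4 [y5 [y6 [y7 ->]]]]]]] := mkP y.
have [z1 [z2 [z3 [z4 [z5 [z6 [z7 ->]]]]]]] := mkP z.
by rewrite !mk_bch; congr mk; field.
Qed.

Lemma BCH_line x (s t : R) : BCH (s *: x) (t *: x) = (s + t) *: x.
Proof.
have [x1 [x2 [x3 [x4 [x5 [x6 [x7 ->]]]]]]] := mkP x.
by rewrite !mkZ !mk_bch; congr mk; field.
Qed.

Lemma BCH0x : left_id 0 BCH.
Proof. by move=> x; have := BCH_line x 0 1; rewrite scale0r add0r scale1r. Qed.

Lemma BCHx0 : right_id 0 BCH.
Proof. by move=> x; have := BCH_line x 1 0; rewrite scale0r addr0 scale1r. Qed.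

Lemma BCHNx : left_inverse 0 -%R BCH.
Proof.
by move=> x; have := BCH_line x (-1) 1; rewrite scaleN1r addNr scale0r scale1r.
Qed.

Lemma BCHxN : right_inverse 0 -%R BCH.
Proof.
by move=> x; have := BCH_line x 1 (-1); rewrite scaleN1r addrN scale0r scale1r.
Qed.

Lemma cvg_lie_bracket (T : Type) (F : set_system T) (FF : Filter F)
    (f g : T -> V) (a b : V) : f @ F --> a -> g @ F --> b ->
  lie_bracket (f t) (g t) @[t --> F] --> lie_bracket a b.
Proof.
move=> fa gb.
have coord (h : T -> V) (c : V) i : h @ F --> c -> h t 0 i @[t --> F] --> c 0 i.
  by move=> hc; apply: (cvg_comp _ _ hc (@coord_continuous R 1 7 0 i c)).
rewrite /lie_bracket; under eq_fun do under eq_bigr do rewrite big_mkcond /=.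
under eq_bigr do rewrite big_mkcond /=.
have sum (h : 'I_7 -> T -> V) (l : 'I_7 -> V) :
    (forall i, h i @ F --> l i) ->
    (\sum_(i < 7) h i t) @[t --> F] --> \sum_(i < 7) l i.
  move=> hl; elim: (index_enum _) => [|i s IH].
    by rewrite big_nil; under eq_fun do rewrite big_nil; exact: cvg_cst.
  by rewrite big_cons; under eq_fun do rewrite big_cons; exact: cvgD.
apply: (sum (fun i t => \sum_(j < 7) if (i < j)%N then _ else 0)) => i /=.
apply: (sum (fun j t => if (i < j)%N then _ else 0)) => j /=.
case: ifP => _; last exact: cvg_cst.
by apply: cvgZr_tmp; apply: cvgB; apply: cvgM; exact: coord.
Qed.

Lemma BCH_continuous : continuous (fun p : V * V => BCH p.1 p.2).
Proof.
move=> p; rewrite /bch6 /continuous_at.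
have c1 : p.1 @[p --> p] --> p.1 by exact: cvg_fst.
have c2 : p.2 @[p --> p] --> p.2 by exact: cvg_snd.
have D (f g : V * V -> V) (a b : V) : f @ p --> a -> g @ p --> b ->
    (fun q => f q + g q) @ p --> a + b by exact: cvgD.
have B (f g : V * V -> V) (a b : V) : f @ p --> a -> g @ p --> b ->
    (fun q => f q - g q) @ p --> a - b by exact: cvgB.
have Z k (f : V * V -> V) (a : V) : f @ p --> a ->
    (fun q => k *: f q) @ p --> k *: a by exact: cvgZl_tmp.
have L (f g : V * V -> V) (a b : V) : f @ p --> a -> g @ p --> b ->
    (fun q => lie_bracket (f q) (g q)) @ p --> lie_bracket a b.
  exact: cvg_lie_bracket.
cbv beta.
repeat lazymatch goal with
  | |- cvg_to _ (nbhs ?l) => lazymatch l with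
    | _ - _ => refine (B _ _ _ _ _ _)
    | _ + _ => refine (D _ _ _ _ _ _)
    | _ *: _ => refine (Z _ _ _ _)
    | lie_bracket _ _ => refine (L _ _ _ _ _ _)
    | fst _ => exact: c1
    | snd _ => exact: c2
    end
  end.
Qed.

(* The Lie algebra of the group law BCH, read off from commutators, is
   [lie_bracket]. *)
Lemma BCH_lie_bracket x y :
  t ^- 2 *: (BCH (t *: x) (t *: y) - BCH (t *: y) (t *: x))
    @[t --> (0 : R)^'] --> lie_bracket x y.
Proof.
have [c3 [c4 [c5 [c6 E]]]] := bch6_expansion lie_bracketZl lie_bracketZr x y.
have [d3 [d4 [d5 [d6 F]]]] := bch6_expansion lie_bracketZl lie_bracketZr y x.
pose r (t : R) := (c3 + t *: c4 + t ^+ 2 *: c5 + t ^+ 3 *: c6)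
  - (d3 + t *: d4 + t ^+ 2 *: d5 + t ^+ 3 *: d6).
have G t : BCH (t *: x) (t *: y) - BCH (t *: y) (t *: x) =
    t ^+ 2 *: (lie_bracket x y + t *: r t).
  rewrite E F (lie_bracketC x y) /r.
  by apply/rowP => i; rewrite !mxE; field.
rewrite -[lie_bracket x y]addr0 -(scale0r (r 0)).
apply: (@cvg_trans _ ((fun t : R => lie_bracket x y + t *: r t) @ (0 : R)^')).
  apply: near_eq_cvg; near=> t.
  rewrite G scalerA mulVf ?scale1r// expf_neq0//.
  by near: t; exact: nbhs_dnbhs_neq.
apply: cvg_within_filter.
apply: cvgD; first exact: cvg_cst.
have p (k : nat) (c : V) : t ^+ k *: c @[t --> (0 : R)] --> (0 : R) ^+ k *: c.
  by apply: cvgZr_tmp; exact: exprn_continuous.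
apply: cvgZ; first exact: cvg_id.
have q (c d e f : V) : c + t *: d + t ^+ 2 *: e + t ^+ 3 *: f
    @[t --> (0 : R)] --> c + 0 *: d + 0 ^+ 2 *: e + 0 ^+ 3 *: f.
  apply: cvgD; [apply: cvgD; [apply: cvgD|]|]; last 2 first.
  - exact: (p 2%N).
  - exact: (p 3%N).
  - exact: cvg_cst.
  - exact: (p 1%N).
by rewrite /r; apply: cvgB; exact: q.
Unshelve. all: by end_near. Qed.

End lie_algebra.

(* The simply connected Lie group with nilpotent Lie algebra g, realised on the
   vector space g by the Baker-Campbell-Hausdorff product, with exp = id. *)
Definition Glambda (R : realType) (lambda : R) : Type := 'rV[R]_7.

Section Glambda_group.
Variables (R : realType) (lambda : R).
Local Notation G := (Glambda lambda).

HB.instance Definition _ := Topological.copy G 'rV[R]_7.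
HB.instance Definition _ := isGroup.Build G (BCHA lambda) (BCH0x lambda)
  (BCHx0 lambda) (BCHNx lambda) (BCHxN lambda).

Let G_mulg_continuous : continuous (fun p : G * G => (p.1 * p.2)%g).
Proof. exact: BCH_continuous. Qed.

Let G_invg_continuous : continuous (fun x : G => x^-1%g).
Proof. exact: (@opp_continuous 'rV[R]_7). Qed.

HB.instance Definition _ :=
  isTopologicalGroup.Build G G_mulg_continuous G_invg_continuous.

End Glambda_group.

(* Main.v *)
(* No lattice. A nonzero linear form in (x_1, x_2) cannot vanish on a lattice
   Gamma, since it would push the invariant probability forward to a
   translation invariant probability on R. Hence Gamma contains two elements
   with independent (x_1, x_2). The x_7-coordinates of the elements of Gamma in
   the centre form a discrete subgroup of R, and iterated commutators produce
   such elements with known x_7. Discreteness first yields k in Gamma with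
   x_1 = 0 and b = x_2 <> 0; then, for g in Gamma with a = x_1 <> 0, commutators
   of g and k have last coordinates a^5 b, a^3 b^2 and lambda a^3 b^2, so that
   lambda is rational.

   Model set. Write lambda = mu / D with mu an algebraic integer, and factor
   its minimal polynomial as p = (X - mu) q over R. The group of R[X]/(p)-points
   is the product of G_lambda and of the group H of R[X]/(q)-points, and the
   points with coordinates in 1440 D Z[X]/(p) form a subgroup. In suitable
   coordinates the product is that of a unitriangular group R^n with subgroup
   Z^n, so that left translations act on [0,1[^n as iterated skew products of
   rotations and preserve the Lebesgue measure. The projection to G_lambda is
   injective because p is irreducible, and the projection to H is dense because
   the multiples of an integer polynomial which is small modulo q (found by
   the pigeonhole principle) form a fine net. *)

Require Import Defs.
From HB Require Import structures.
From mathcomp Require Import all_boot all_order all_algebra.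
From mathcomp Require Import all_classical all_reals all_analysis.
From mathcomp Require Import measurable_realfun ring lra.

Set Implicit Arguments.
Unset Strict Implicit.
Unset Printing Implicit Defensive.

Import Order.TTheory GRing.Theory Num.Theory numFieldNormedType.Exports.

Local Open Scope classical_set_scope.
Local Open Scope ring_scope.

(** * Coordinates and weights in G_lambda *)

Section bracket_coordinates.
Variables (S : comNzRingType) (l : S).

(* Coordinates are indexed by 1, ..., 7, as the basis X_1, ..., X_7. *)
Definition bracket_coord (x y : nat -> S) (k : nat) : S :=
  match k with
  | 3%N => x 1%N * y 2%N - x 2%N * y 1%N
  | 4%N => x 1%N * y 3%N - x 3%N * y 1%N
  | 5%N => x 1%N * y 4%N - x 4%N * y 1%N + (x 2%N * y 3%N - x 3%N * y 2%N)
  | 6%N => x 1%N * y 5%N - x 5%N * y 1%N + (x 2%N * y 4%N - x 4%N * y 2%N)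
  | 7%N => x 1%N * y 6%N - x 6%N * y 1%N + l * (x 2%N * y 5%N - x 5%N * y 2%N) +
         (1 - l) * (x 3%N * y 4%N - x 4%N * y 3%N)
  | _ => 0
  end.
End bracket_coordinates.

Section coords.
Variable (R : realType).
Definition coord7 (x : 'rV[R]_7) (k : nat) : R := x 0 (inord k.-1).

Lemma coord7_inj (x y : 'rV[R]_7) :
  (forall k, (0 < k <= 7)%N -> coord7 x k = coord7 y k) -> x = y.
Proof.
move=> xy; apply/rowP => k; have := xy k.+1 (ltn_ord k).
by rewrite /coord7 /= inord_val.
Qed.

Lemma coord7D x y k : coord7 (x + y) k = coord7 x k + coord7 y k.
Proof. by rewrite /coord7 mxE. Qed.
Lemma coord7N x k : coord7 (- x) k = - coord7 x k.
Proof. by rewrite /coord7 mxE. Qed.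
Lemma coord7Z a x k : coord7 (a *: x) k = a * coord7 x k.
Proof. by rewrite /coord7 mxE. Qed.

Lemma coord7_bracket lambda x y k : (0 < k <= 7)%N ->
  coord7 (lie_bracket lambda x y) k =
  bracket_coord lambda (coord7 x) (coord7 y) k.
Proof.
have E (z : 'rV[R]_7) (i : 'I_7) : z 0 i = coord7 z i.+1.
  by rewrite /coord7 /= inord_val.
move=> k7; rewrite {1}/coord7 /lie_bracket.
under eq_bigr do rewrite big_mkcond /=.
rewrite !big_ord_recl !big_ord0 /= !(scaler0, addr0, add0r) !mxE !E.
case: k k7 => [//|[|[|[|[|[|[|[|//]]]]]]]] _ /=;
  rewrite inordK //= /bump /= ?(mulr0, mulr1, addr0, add0r);
  ring.
Qed.

End coords.

Section bch_ideal.
Variables (R : fieldType) (V : lmodType R) (br : V -> V -> V) (I : V -> Prop).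
Hypotheses (ID : forall x y, I x -> I y -> I (x + y))
  (IZ : forall a x, I x -> I (a *: x)) (Ibr : forall x y, I y -> I (br x y)).

(** Every term of [bch6] of degree at least 3 is an iterated bracket whose three innermost letters
    form one of the four words in the hypotheses. *)
Lemma bch6_ideal (x y : V) : I (br x (br x y)) -> I (br x (br y x)) ->
  I (br y (br x y)) -> I (br y (br y x)) ->
  I (bch6 br x y - (x + y + 2^-1 *: br x y)).
Proof.
move=> xxy xyx yxy yyx.
have IN z : I z -> I (- z) by move=> Iz; rewrite -scaleN1r; exact: IZ.
rewrite /bch6; set z := x + y + 2^-1 *: br x y.
set t1 := 12^-1 *: _; set t2 := 24^-1 *: _; set t3 := 720^-1 *: (_ + _).
set t4 := 360^-1 *: _; set t5 := 120^-1 *: _; set t6 := 240^-1 *: _.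
set t7 := 720^-1 *: (_ - _); set t8 := 1440^-1 *: _.
clearbody z.
have -> : z + t1 - t2 - t3 + t4 + t5 + t6 + t7 + t8 - z =
    t1 - t2 - t3 + t4 + t5 + t6 + t7 + t8.
  by rewrite [LHS]addrC !addrA addNr add0r.
repeat first [ apply: ID | apply: IN ];
  apply: IZ; do ?[exact: xxy | exact: xyx | exact: yxy | exact: yyx
                 | apply: ID | apply: IN | apply: Ibr].
Qed.

End bch_ideal.

Section filtration.
Variables (R : realType) (lambda : R).
Local Notation V := 'rV[R]_7.
Local Notation br := (lie_bracket lambda).
Local Notation G := (Glambda lambda).
Implicit Types (x y z : V) (w k : nat).

(** This is the span of X_w, ..., X_7. Giving X_i the weight i makes the Lie algebra graded, since
    [X_i, X_j] is always a multiple of X_(i+j), or 0 when i + j > 7. *)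
Definition weight_ge w x :=
  forall k, (0 < k <= 7)%N -> (k < w)%N -> coord7 x k = 0.

Lemma weight_geD w x y : weight_ge w x -> weight_ge w y -> weight_ge w (x + y).
Proof. by move=> xw yw k k7 kw; rewrite coord7D xw// yw// addr0. Qed.

Lemma weight_geZ w a x : weight_ge w x -> weight_ge w (a *: x).
Proof. by move=> xw k k7 kw; rewrite coord7Z xw// mulr0. Qed.

Lemma weight_geN w x : weight_ge w x -> weight_ge w (- x).
Proof. by move=> xw; rewrite -scaleN1r; exact: weight_geZ. Qed.

Lemma weight_ge_leq w w' x : (w' <= w)%N -> weight_ge w x -> weight_ge w' x.
Proof. by move=> ww' xw k k7 kw; apply: xw => //; exact: leq_trans ww'. Qed.

Lemma weight_ge1 x : weight_ge 1 x.
Proof. by case. Qed.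

Lemma weight_ge_bracket i j x y : (0 < i)%N -> (0 < j)%N ->
  weight_ge i x -> weight_ge j y ->
  weight_ge (i + j) (br x y).
Proof.
move=> i0 j0 xi yj k k7 kij; rewrite coord7_bracket//.
have Z a b : (0 < a <= 7)%N -> (0 < b <= 7)%N -> (a + b < i + j)%N ->
    coord7 x a * coord7 y b = 0.
  move=> a7 b7 ab; have [ai|ia] := ltnP a i; first by rewrite xi ?mul0r.
  rewrite yj ?mulr0//.
  by rewrite -(ltn_add2l a); apply: leq_trans ab _; rewrite leq_add2r.
case: k k7 kij => [//|[|[|[|[|[|[|[|//]]]]]]]] _ /= kij //;
 by rewrite !Z // ?(subrr, addr0, mulr0).
Qed.

Lemma weight_ge_bracketr w x y : (0 < w)%N -> weight_ge w y ->
  weight_ge w.+1 (br x y).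
Proof.
by move=> w0 yw; rewrite -add1n; apply: weight_ge_bracket => //;
  exact: weight_ge1.
Qed.

Lemma lie_bracketDr x y z : br x (y + z) = br x y + br x z.
Proof.
apply: coord7_inj => k k7; rewrite coord7D !coord7_bracket//.
by case: k k7 => [//|[|[|[|[|[|[|[|//]]]]]]]] _ /=; rewrite ?coord7D; ring.
Qed.

(** Each remaining term brackets [x, y] or [y, x] at least once more, and every further bracket
    raises the weight by at least one. *)
Lemma bch6_weight w x y : (0 < w)%N -> weight_ge w (br x y) ->
  weight_ge w.+1 (bch6 br x y - (x + y + 2^-1 *: br x y)).
Proof.
move=> w0 xyw; have yxw : weight_ge w (br y x).
  by rewrite lie_bracketC; exact: weight_geN.
apply: (@bch6_ideal _ _ br (weight_ge w.+1)); try exact: weight_ge_bracketr.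
- exact: weight_geD.
- exact: weight_geZ.
- move=> u v uv; apply: (@weight_ge_leq w.+2) => //.
  exact: weight_ge_bracketr.
Qed.

Definition group_comm (x y : G) : G := ((x * y) * (y * x)^-1)%g.

(* The leading term of a group commutator is the Lie bracket: writing
   u = x * y and v = (y * x)^-1, the sum u + v is [x, y] up to higher weight,
   and [u, v] = [u, u + v] has higher weight than u + v. *)
Lemma group_comm_weight w (x y : G) : (0 < w)%N -> weight_ge w (br x y) ->
  weight_ge w.+1 ((group_comm x y : V) - br x y).
Proof.
move=> w0 xyw; have yxw : weight_ge w (br y x).
  by rewrite lie_bracketC; exact: weight_geN.
pose u : V := bch6 br x y; pose v : V := - bch6 br y x.
have -> : group_comm x y = bch6 br u v by [].
have uv : weight_ge w.+1 (u + v - br x y).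
  have -> : u + v - br x y = (bch6 br x y - (x + y + 2^-1 *: br x y))
      - (bch6 br y x - (y + x + 2^-1 *: br y x)).
    rewrite /u /v (lie_bracketC _ x y).
    move: (bch6 br x y) (bch6 br y x) (br x y) => a b c.
    by apply: coord7_inj => k k7; rewrite !(coord7D, coord7N, coord7Z); field.
  apply: (weight_geD (bch6_weight w0 xyw)).
  exact: (weight_geN (bch6_weight w0 yxw)).
have uv' : weight_ge w (u + v).
  rewrite -(subrK (br x y) (u + v)); apply: weight_geD => //.
  exact: weight_ge_leq uv.
have buv : weight_ge w.+1 (br u v).
  have -> : br u v = br u (u + v) by rewrite lie_bracketDr lie_bracketxx add0r.
  exact: weight_ge_bracketr.
rewrite (_ : _ - _ = (bch6 br u v - (u + v + 2^-1 *: br u v)) +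
   (u + v - br x y) + 2^-1 *: br u v); last first.
  move: (bch6 br u v) (br u v) (br x y) => a b c.
  clearbody u v.
  by apply: coord7_inj => k k7; rewrite !(coord7D, coord7N, coord7Z); ring.
apply: weight_geD; [apply: weight_geD|exact: weight_geZ] => //.
apply: (@weight_ge_leq w.+2) => //; exact: bch6_weight.
Qed.

Lemma weight_ge_group_comm w (x y : G) : (0 < w <= 7)%N ->
  weight_ge w (br x y) ->
  weight_ge w (group_comm x y) /\
  coord7 (group_comm x y) w = bracket_coord lambda (coord7 x) (coord7 y) w.
Proof.
move=> /andP[w0 w7] xyw; have cw := group_comm_weight w0 xyw; split.
  rewrite -(subrK (br x y) (group_comm x y)); apply: weight_geD => //.
  exact: weight_ge_leq cw.
rewrite -coord7_bracket ?w0//; apply/eqP; rewrite -subr_eq0 -coord7N -coord7D.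
by rewrite cw ?w0.
Qed.

(** Brackets have weight at least 3, so x_1 and x_2 are homomorphisms to R: they are the coordinates
    of the abelianization. *)
Lemma coord7_mulg k (x y : G) : (k == 1)%N || (k == 2)%N ->
  coord7 (x * y)%g k = coord7 x k + coord7 y k.
Proof.
have b3 : weight_ge 3 (br x y).
  move=> j /[swap]; case: j => [//|[|[|//]]] _ _;
  by rewrite coord7_bracket.
move=> k12; have k7 : (0 < k <= 7)%N by case/orP: k12 => /eqP ->.
apply/eqP; rewrite -coord7D -subr_eq0 -coord7N -coord7D.
have -> : (x * y)%g - ((x : V) + y) =
  ((x * y)%g - ((x : V) + y + 2^-1 *: br x y)) + 2^-1 *: br x y.
  move: (x * y)%g (br x y) => a c.
  by apply: coord7_inj => j j7; rewrite !(coord7D, coord7N, coord7Z); ring.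
have k3 : (k < 3)%N by case/orP: k12 => /eqP ->.
apply/eqP; rewrite coord7D (@bch6_weight 3 x y)// ?add0r; last exact: ltnW.
by rewrite coord7Z b3// mulr0.
Qed.

Lemma coord7_invg k (x : G) : coord7 (x^-1)%g k = - coord7 x k.
Proof. exact: coord7N. Qed.

End filtration.

(** * Lattices and rationality of lambda *)

Section subgroup_cosets.
Variables (G : topologicalGroupType) (Gamma : set G).
Hypothesis Gamma_group : group_closed [in Gamma].

Lemma subgroup1 : Gamma 1%g.
Proof. by case: Gamma_group; rewrite in_setE. Qed.

Lemma subgroupV x : Gamma x -> Gamma (x^-1)%g.
Proof.
by move=> Gx; have := group_closedV Gamma_group; move=> /(_ x);
  rewrite !in_setE; apply.
Qed.

Lemma subgroupM x y : Gamma x -> Gamma y -> Gamma (x * y)%g.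
Proof.
by move=> Gx Gy; have := group_closedM Gamma_group;
  move=> /(_ x y); rewrite !in_setE; apply.
Qed.

Lemma coset_mulr (x z : G) : Gamma z ->
  (\pi_(coset_space Gamma) (x * z)%g = \pi_(coset_space Gamma) x)%qT.
Proof.
move=> Gz; apply/eqmodP/asboolP/seteqP; split=> _ [u Gu <-].
  by exists (z * u)%g; [exact: subgroupM|rewrite mulgA].
exists (z^-1 * u)%g; first by apply: subgroupM => //; exact: subgroupV.
by rewrite -mulgA mulVKg.
Qed.

End subgroup_cosets.

Section commensurable.
Variables (R : realType) (A : set R).
Hypotheses (AB : forall x y, A x -> A y -> A (x - y)).

Lemma subgroup_mulrz (x : R) (k : int) : A x -> A (x *~ k).
Proof.
move=> Ax; have A0 : A 0 by rewrite -(subrr x); exact: AB.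
have AN y : A y -> A (- y) by move=> Ay; rewrite -sub0r; exact: AB.
have An n y : A y -> A (y *+ n).
  move=> Ay; elim: n => [//|n IH]; rewrite mulrSr -[X in _ + X]opprK.
  by apply: (AB IH); exact: AN.
by case: k => n; [exact: An|rewrite NegzE mulrNz; apply: AN; exact: An].
Qed.

(* The gap at 0 yields a least positive element, which generates A. *)
Lemma discrete_commensurable (e u v : R) : 0 < e ->
  (forall x, A x -> `|x| < e -> x = 0) -> A u -> A v -> v != 0 ->
  exists p q : int, q != 0 /\ u *~ q = v *~ p.
Proof.
move=> e0 gap Au Av v0.
pose P := [set x | A x /\ 0 < x].
have P0 : P !=set0.
  have [v_gt0|v_le0] := ltP 0 v; first by exists v.
  exists (- v); split; last by rewrite oppr_gt0 lt_neqAle v0.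
  by rewrite -sub0r; apply: AB => //; rewrite -(subrr v); exact: AB.
have hP : has_inf P by split=> //; exists 0 => x [_ /ltW].
have [g [Ag g0] gm] := inf_adherent e0 hP.
(* Since g is within e of the infimum, an x of A strictly between 0 and g would give g - x in A with
   0 < g - x < e, against the gap. So g is the minimum of [P]. *)
have g_min x : A x -> 0 <= x -> x < g -> x = 0.
  move=> Ax x0 xg; apply: contrapT => /eqP xn0.
  have Px : P x by split=> //; rewrite lt_neqAle eq_sym xn0.
  have mx : inf P <= x by apply: ge_inf => //; case: hP.
  have : g - x = 0.
    by apply: gap; [exact: AB|rewrite gtr0_norm ?subr_gt0//; lra].
  by lra.
(* Euclidean division by g: the remainder lies in A and in [0, g[, hence vanishes. *)
have g_mul x : A x -> exists k : int, x = g *~ k.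
  move=> Ax; exists (Num.floor (x / g)).
  have := g_min (x - g *~ Num.floor (x / g)).
  have /andP[f1 f2] := floor_itv (x / g).
  rewrite ler_pdivlMr// in f1; rewrite ltr_pdivrMr// intrD in f2.
  move=> /(_ (AB Ax (subgroup_mulrz _ Ag))) h; apply/eqP; rewrite -subr_eq0.
  by apply/eqP; apply: h; rewrite -mulrzr; lra.
have [k uk] := g_mul _ Au; have [l vl] := g_mul _ Av.
exists k, l; split; last by rewrite uk vl -!mulrzA mulrC.
by apply: contra_neq v0 => l0; rewrite vl l0.
Qed.
End commensurable.

(** * Homomorphisms to R vanishing on a lattice *)

Section mean.
Variables (R : realType) (G : topologicalGroupType).
Variables (Gamma : set G) (mu : probability (borel_coset_space Gamma) R).
Hypothesis muG : invariant_probability mu.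
Hypothesis Gamma1 : Gamma 1%g.

Lemma same_coset_repr (x : G) :
  exists2 z, Gamma z & repr (\pi_(coset_space Gamma) x)%qT = (x * z)%g.
Proof.
have /eqmodP/asboolP e := reprK ((\pi_(coset_space Gamma) x)%qT).
set y := repr _ in e *.
have : [set (y * z)%g | z in Gamma] y by exists 1%g => //; rewrite mulg1.
by rewrite e => -[z Gz xz]; exists z.
Qed.

Variable (f : G -> R).
Hypotheses (fM : forall x y, f (x * y)%g = f x + f y)
  (f_cont : continuous f) (fG : forall z, Gamma z -> f z = 0)
  (f_surj : forall r, exists x, f x = r).

Let F (q : coset_space Gamma) : R := f (repr q).

(** Since f vanishes on Gamma, it descends to F on the coset space. Translating by g with f g = r
    shows that the sets F < r all have the same measure, and they increase to the whole space. *)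
Lemma mean_half_line : measurable
  ([set q | F q < 0] : set (borel_coset_space Gamma)) /\
  mu [set q | F q < 0] = 1%E.
Proof.
have Fpi x : F (\pi x)%qT = f x.
  rewrite /F; have [z Gz ->] := same_coset_repr x.
  by rewrite fM (fG Gz) addr0.
pose U (r : R) := [set q | F q < r].
have mU r : measurable (U r : set (borel_coset_space Gamma)).
  apply: sub_sigma_algebra; rewrite /open/= /quotient_open.
  rewrite (_ : _ @^-1` _ = f @^-1` [set t | t < r]).
    by apply: open_comp => //; exact: lt_open.
  by apply/seteqP; split=> x /=; rewrite /U /= Fpi.
split; first exact: mU.
have muU r : mu (U r) = mu (U 0).
  have [g fg] := f_surj r.
  rewrite -(muG g (mU r)); congr (mu _); apply/seteqP.
  suff H q : F (coset_act g q) = r + F q.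
    by split=> q; rewrite /U/= H; lra.
  by rewrite -(reprK q) coset_actE !Fpi fM fg.
have : mu (U n%:R) @[n --> \oo] --> mu (\bigcup_n U n%:R).
  apply: nondecreasing_cvg_mu => //.
  - exact: bigcup_measurable.
  - move=> n m nm; apply/subsetPset => q /=; rewrite /U /= => h.
    by apply: lt_le_trans h _; rewrite ler_nat.
have -> : \bigcup_n U n%:R = setT.
  apply/seteqP; split=> // q _; exists (Num.truncn (F q)).+1 => //=.
  exact: truncnS_gt.
under eq_cvg do rewrite muU.
rewrite probability_setT => cv.
have /cvg_lim <- // : (fun _ : nat => mu (U 0)) @ \oo --> 1%E by exact: cv.
by rewrite lim_cst.
Qed.

End mean.

(** Otherwise [mean_half_line], applied to f and to -f, would give two disjoint sets of measure
    1. *)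
Lemma lattice_not_in_kernel (R : realType) (G : topologicalGroupType)
    (Gamma : set G) (f : G -> R) : lattice R Gamma ->
  (forall x y, f (x * y)%g = f x + f y) -> continuous f ->
  (forall r, exists x, f x = r) -> exists2 z, Gamma z & f z != 0.
Proof.
move=> [[[G1 _] _] [mu muG]] fM f_cont f_surj; apply: contrapT => H.
rewrite in_setE in G1.
have fG z : Gamma z -> f z = 0.
  by move=> Gz; apply: contrapT => /eqP fz; apply: H; exists z.
have [mA A1] := mean_half_line muG G1 fM f_cont fG f_surj.
have [||||mB B1] := mean_half_line (f := fun x => - f x) muG G1.
- by move=> x y; rewrite fM opprD.
- by move=> x; apply: cvgN; exact: f_cont.
- by move=> z Gz; rewrite fG// oppr0.
- by move=> r; have [x fx] := f_surj (- r); exists x; rewrite fx opprK.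
have := @probability_le1 _ _ _ mu _ (measurableU _ _ mA mB).
rewrite measureU//; last first.
  by apply/seteqP; split=> // q [/=]; rewrite oppr_lt0 => /lt_trans h /h;
    rewrite ltxx.
rewrite [X in (X <= _)%E](_ : _ = (1 + 1)%E); last by congr (_ + _)%E.
by rewrite -EFinD lee_fin gerDl ler10.
Qed.

Lemma continuous_lin (R : realType) (T : topologicalType) (f g : T -> R)
    (s t : R) : continuous f -> continuous g ->
  continuous (fun x => s * f x + t * g x).
Proof.
move=> cf cg x; apply: cvgD; apply: cvgMl_tmp; [exact: cf|exact: cg].
Qed.

(** If q (a', b') = p (a, b), the determinant of the two vectors is killed by q. *)
Lemma det_mulrz (R : realType) (a b a' b' : R) (p q : int) :
  a' *~ q = a *~ p -> b' *~ q - b *~ p = 0 -> (- b * a' + a * b') *~ q = 0.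
Proof.
rewrite -(mulrzr a' q) -(mulrzr a p) -(mulrzr b' q) -(mulrzr b p) => e1 /eqP.
rewrite subr_eq0 => /eqP e2.
by rewrite -[LHS]mulrzr; ring: e1 e2.
Qed.

(** * Commutators in a lattice of G_lambda *)

Section no_lattice.
Variables (R : realType) (lambda : R).
Local Notation V := 'rV[R]_7.
Local Notation br := (lie_bracket lambda).
Local Notation G := (Glambda lambda).
Local Notation c := (@coord7 R).

Variable Gamma : set G.
Hypothesis latG : lattice R Gamma.

Let Gamma_group : group_closed [in Gamma] := latG.1.1.

Let Gamma1 : Gamma 1%g := subgroup1 Gamma_group.

Let GammaI x : Gamma x -> Gamma (x^-1)%g.
Proof. exact: subgroupV. Qed.

Let GammaM x y : Gamma x -> Gamma y -> Gamma (x * y)%g.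
Proof. exact: subgroupM. Qed.

Let GammaV x y : Gamma x -> Gamma y -> Gamma (x / y)%g.
Proof. by move=> Gx Gy; apply: GammaM => //; exact: GammaI. Qed.

Let Gamma_comm x y : Gamma x -> Gamma y -> Gamma (group_comm x y).
Proof. by move=> Gx Gy; apply: GammaV; exact: GammaM. Qed.

Let coord7_continuous k : continuous (fun x : G => c x k).
Proof. exact: coord_continuous. Qed.

Let not_in_kernel (s t : R) : s != 0 \/ t != 0 ->
  exists2 z, Gamma z & s * c z 1 + t * c z 2 != 0.
Proof.
move=> st; apply: (lattice_not_in_kernel
  (f := fun x : G => s * c x 1 + t * c x 2) latG).
- by move=> x y; rewrite !coord7_mulg//; ring.
- by apply: continuous_lin; exact: coord7_continuous.
move=> r.
have X12 k : c (basis_vec R k) 1 = (1 == k)%:R /\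
  c (basis_vec R k) 2 = (2 == k)%:R.
  by rewrite /c !mxE !inordK.
case: st => [s0|t0].
  exists ((r / s) *: basis_vec R 1); rewrite !coord7Z.
  by have [-> ->] := X12 1%N; rewrite mulr0 mulr0 addr0 mulr1 mulrC divfK.
exists ((r / t) *: basis_vec R 2); rewrite !coord7Z.
by have [-> ->] := X12 2%N; rewrite mulr0 mulr0 add0r mulr1 mulrC divfK.
Qed.

Let Gamma_pow x (p : int) : Gamma x ->
  exists y, [/\ Gamma y, c y 1 = c x 1 *~ p & c y 2 = c x 2 *~ p].
Proof.
have Gn z (n : nat) : Gamma z ->
  exists y, [/\ Gamma y, c y 1 = c z 1 *+ n & c y 2 = c z 2 *+ n].
  move=> Gz; elim: n => [|n [y [Gy y1 y2]]].
    by exists 1%g; split; rewrite // /coord7 mxE.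
  by exists (y * z)%g; split; [exact: GammaM| |];
    rewrite coord7_mulg// mulrSr ?y1 ?y2.
case: p => n Gx; first exact: Gn.
have [y [Gy y1 y2]] := Gn (x^-1)%g n.+1 (GammaI Gx).
by exists y; split; rewrite // NegzE mulrNz -mulNrn -coord7_invg.
Qed.

Let A := [set r | exists x, [/\ Gamma x, weight_ge 7 x & c x 7 = r]].

Let A_subgroup x y : A x -> A y -> A (x - y).
Proof.
move=> [u [Gu u7 <-]] [v [Gv v7 <-]]; exists (u / v)%g.
have nv7 := weight_geN v7.
have b0 : br u (- v) = 0.
  apply: coord7_inj => k k7; rewrite coord7_bracket// [RHS]mxE.
  by case: k k7 => [//|[|[|[|[|[|[|[|//]]]]]]]] _ //=;
    rewrite !u7 // !nv7 // !mul0r !subr0 ?addr0 ?mulr0 ?addr0.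
have uvE : (u / v)%g = (u : V) - v.
  rewrite -[LHS]/(bch6 br u (- v)); apply/eqP; rewrite -subr_eq0; apply/eqP.
  apply: coord7_inj => k k7; rewrite [RHS]mxE.
  (* A vector of weight at least 8 is 0. As the bracket vanishes, it has weight 8, and so the
     product is exactly the sum. *)
  have := @bch6_weight _ lambda 8 u (- v) isT.
  rewrite b0 scaler0 addr0; apply => //.
    by move=> j _ _; rewrite /coord7 mxE.
  by case/andP: k7 => _ k7; rewrite ltnS ltnW// ltnS.
split; first exact: GammaV.
  by rewrite uvE; exact: weight_geD.
by rewrite uvE coord7D coord7N.
Qed.

Let A_gap : exists2 e : R, 0 < e & forall r, A r -> `|r| < e -> r = 0.
Proof.
have [_ /(_ _ Gamma1) [_ [U U1 UG]]] := latG.1.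
have /nbhs_ballP[e /= e0 eU] : nbhs (0 : V) U by exact: U1.
exists e => // r [x [Gx x7 <-]] xe.
have : (U `&` Gamma) x.
  split=> //; apply: eU; split=> // i j.
  rewrite ord1 mxE /ball /= sub0r normrN.
  have -> : x 0 j = c x j.+1 by rewrite /coord7 /= inord_val.
  have [j7|] := ltnP j.+1 7; first by rewrite x7 ?normr0 //= ltnW.
  by move=> j7; rewrite (_ : j.+1 = 7%N)//; apply/eqP;
    rewrite eqn_leq j7 ltn_ord.
by rewrite UG => ->; rewrite /coord7 mxE.
Qed.

Let commensurable u v : A u -> A v -> v != 0 ->
  exists p q : int, q != 0 /\ u *~ q = v *~ p.
Proof.
by have [e e0 gap] := A_gap; exact: (discrete_commensurable A_subgroup e0 gap).
Qed.

Let comm_exists x y w : Gamma x -> Gamma y -> (0 < w <= 7)%N ->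
  weight_ge w (br x y) ->
  exists z, [/\ Gamma z, weight_ge w z &
    c z w = bracket_coord lambda (c x) (c y) w].
Proof.
move=> Gx Gy w7 xyw; exists (group_comm x y).
by have [] := weight_ge_group_comm w7 xyw; split => //; exact: Gamma_comm.
Qed.

(** Only [X_1, X_w] = X_(w+1) contributes to the leading coordinate, all other terms involving a
    coordinate of y of index below w. The case w = 1 is excluded because [X_1, X_1] = 0. *)
Let comm_step x y w : Gamma x -> Gamma y -> (1 < w < 7)%N -> weight_ge w y ->
  exists z, [/\ Gamma z, weight_ge w.+1 z & c z w.+1 = c x 1 * c y w].
Proof.
move=> Gx Gy /andP[w1 w7] yw; have w0 := ltnW w1.
have [||z [Gz zw zc]] := @comm_exists x y w.+1 Gx Gy; rewrite ?w7//.
  exact: weight_ge_bracketr.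
exists z; split=> //; rewrite zc.
by case: w w1 w7 w0 yw zw zc => [//|[//|[|[|[|[|[|//]]]]]]] _ _ _ yw _ _ /=;
  try rewrite (yw 1%N isT isT); try rewrite (yw 2%N isT isT);
  try rewrite (yw 3%N isT isT); try rewrite (yw 4%N isT isT);
  try rewrite (yw 5%N isT isT); rewrite ?(mulr0, subr0, addr0).
Qed.

(** Taking the commutator with x, 7 - w times, pushes y into the centre; each step multiplies the
    leading coordinate by x_1. *)
Let comm_to_center x y w : Gamma x -> Gamma y -> (1 < w <= 7)%N ->
  weight_ge w y -> A (c x 1 ^+ (7 - w) * c y w).
Proof.
move=> Gx + /andP[+ w7]; rewrite -{1 2 4}(subKn w7).
elim: (7 - w)%N (leq_subr w 7) y => [|n IH] n7 y Gy w1 yw.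
  by rewrite expr0 mul1r; exists y.
have e : (7 - n = (7 - n.+1).+1)%N by rewrite subnSK.
have [|z [Gz zw zc]] := comm_step Gx Gy _ yw.
  by rewrite w1 /= -[X in (X <= 7)%N]e leq_subr.
rewrite exprSr -mulrA -zc -e; apply: (IH (ltnW n7)) => //.
  by rewrite e ltnW.
by rewrite e.
Qed.

Lemma lattice_rational : rational lambda.
Proof.
have [g Gg] := @not_in_kernel 1 0 (or_introl (oner_neq0 R)).
rewrite mul0r addr0 mul1r => g1.
(* The linear form is the determinant against (g_1, g_2), so h is independent of g in the
   abelianization. *)
have [h Gh] := not_in_kernel (or_intror g1 : - c g 2 != 0 \/ c g 1 != 0).
set D := _ + _ => D0.
(* The commutator of g and h has third coordinate [D]; three more commutators with g give an element
   of weight 6 with leading coordinate g_1^3 D. *)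
have [|z3 [Gz3 z3w /= z3c]] := @comm_exists g h 3 Gg Gh isT.
  by move=> j /[swap]; case: j => [//|[|[|//]]] _ _; rewrite coord7_bracket.
have {}z3c : c z3 3 = D by rewrite z3c /D; ring.
have [z4 [Gz4 z4w z4c]] := @comm_step _ _ 3 Gg Gz3 isT z3w.
have [z5 [Gz5 z5w z5c]] := @comm_step _ _ 4 Gg Gz4 isT z4w.
have [z6 [Gz6 z6w z6c]] := @comm_step _ _ 5 Gg Gz5 isT z5w.
have z60 : c z6 6 != 0 by rewrite z6c z5c z4c z3c !mulf_neq0.
(* The central elements obtained from [z6] with g and with h have last coordinates in the ratio g_1
   : h_1, which is therefore rational. *)
have Ag := @comm_to_center _ _ 6 Gg Gz6 isT z6w.
have Ah := @comm_to_center _ _ 6 Gh Gz6 isT z6w.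
have [|p [q [q0]]] := commensurable Ah Ag.
  by rewrite mulf_neq0// expf_neq0.
rewrite -!mulrzAl => /(mulIf z60); rewrite !expr1 => pq.
(* With h_1 q = g_1 p, the quotient of h^q by g^p has x_1 = 0; its x_2 cannot vanish too, by
   independence of g and h. *)
have [u [Gu u1 u2]] := Gamma_pow q Gh.
have [v [Gv v1 v2]] := Gamma_pow p Gg.
have [k [Gk k1 k2]] : exists k, [/\ Gamma k, c k 1 = 0 & c k 2 != 0].
  exists (u / v)%g; split; first exact: GammaV.
    by rewrite coord7_mulg// coord7_invg u1 v1 pq subrr.
  rewrite coord7_mulg// coord7_invg u2 v2; apply: contra_neq D0 => k2.
  have : D *~ q = 0.
    exact: (det_mulrz pq k2).
  by move=> /eqP; rewrite mulrz_eq0 (negPf q0) /= => /eqP.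
have kw : weight_ge 2 k by case=> [//|[|//]].
(* With a = g_1 and b = k_2, the leading coordinates of [k3], [k4], [k5] are a b, a^2 b, a^3 b, and
   [A1] puts a^5 b in [A]. *)
have [k3 [Gk3 k3w k3c]] := @comm_step _ _ 2 Gg Gk isT kw.
have [k4 [Gk4 k4w k4c]] := @comm_step _ _ 3 Gg Gk3 isT k3w.
have [k5 [Gk5 k5w k5c]] := @comm_step _ _ 4 Gg Gk4 isT k4w.
have A1 := @comm_to_center _ _ 2 Gg Gk isT kw.
(* [X_2, X_3] = X_5 gives the leading coordinate a b^2, hence a^3 b^2 in [A]. *)
have [|l5 [Gl5 l5w /=]] := @comm_exists k k3 5 Gk Gk3 isT.
  exact: (@weight_ge_bracket R lambda 2 3 k k3 isT isT kw k3w).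
rewrite k1 (k3w 1%N isT isT) (k3w 2%N isT isT).
rewrite !(mul0r, mulr0, subr0, add0r) k3c => l5c.
have A2 := @comm_to_center _ _ 5 Gg Gl5 isT l5w; rewrite l5c in A2.
(* [X_2, X_5] = lambda X_7 is where lambda enters: lambda a^3 b^2 is in [A]. *)
have [|l7 [Gl7 l7w /=]] := @comm_exists k k5 7 Gk Gk5 isT.
  exact: (@weight_ge_bracket R lambda 2 5 k k5 isT isT kw k5w).
rewrite k1 (k5w 1%N isT isT) (k5w 2%N isT isT) (k5w 3%N isT isT)
  (k5w 4%N isT isT).
rewrite !(mul0r, mulr0, subr0, oppr0, add0r, addr0) k5c k4c k3c => l7c.
have A3 : A (lambda * (c k 2 * (c g 1 * (c g 1 * (c g 1 * c k 2)))))
  by exists l7.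
(* After cancelling a^3 b, the two relations read b q1 = a^2 p1 and lambda b q2 = a^2 p2; their
   quotient gives lambda. *)
have [|p1 [q1 [q10 e1]]] := commensurable A2 A1.
  by rewrite mulf_neq0// expf_neq0.
have [|p2 [q2 [q20 e2]]] := commensurable A3 A1.
  by rewrite mulf_neq0// expf_neq0.
move: e1 e2 g1 k2 => /=; set a := c g 1; set b := c k 2; clearbody a b.
rewrite -[_ *~ q1]mulrzr -[_ *~ p1]mulrzr -[_ *~ q2]mulrzr -[_ *~ p2]mulrzr.
rewrite (_ : 7 - 5 = 2)%N// (_ : 7 - 2 = 5)%N// => e1 e2 a0 b0.
have q1R : q1%:~R != 0 :> R by rewrite intr_eq0.
have q2R : q2%:~R != 0 :> R by rewrite intr_eq0.
have e1' : b * q1%:~R = a ^+ 2 * p1%:~R.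
  apply: (@mulfI _ (a ^+ 3 * b)); first by rewrite mulf_neq0// expf_neq0.
  by ring: e1.
have e2' : lambda * b * q2%:~R = a ^+ 2 * p2%:~R.
  apply: (@mulfI _ (a ^+ 3 * b)); first by rewrite mulf_neq0// expf_neq0.
  by ring: e2.
have p10 : p1%:~R != 0 :> R.
  by apply: contra_neq b0 => p0; apply: (mulIf q1R); rewrite e1' p0 mul0r mulr0.
exists (p2%:~R * q1%:~R / (p1%:~R * q2%:~R)) => //.
rewrite fmorph_div /= !rmorphM /= !ratr_int.
apply: (mulIf (mulf_neq0 p10 q2R)); rewrite divfK ?mulf_neq0//.
apply: (@mulfI _ (a ^+ 2)); first by rewrite expf_neq0.
apply: esym.
transitivity (a ^+ 2 * p1%:~R * (lambda * q2%:~R)); first by ring.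
rewrite -e1'; transitivity (lambda * b * q2%:~R * q1%:~R); first by ring.
by rewrite e2'; ring.
Qed.

End no_lattice.

(** * Borel sets of row vectors *)

Lemma cvg_sum_seq (R : realType) (T I : Type) (F : set_system T) (FF : Filter F)
    (s : seq I) (f : I -> T -> R) (l : I -> R) : (forall i, f i @ F --> l i) ->
  \sum_(i <- s) f i t @[t --> F] --> \sum_(i <- s) l i.
Proof.
move=> fl; elim: s => [|i s IH].
  by rewrite big_nil; under eq_fun do rewrite big_nil; exact: cvg_cst.
by rewrite big_cons; under eq_fun do rewrite big_cons; exact: cvgD.
Qed.

Section row_vector_topology.
Variables (R : realType) (n : nat).
Local Notation V := 'rV[R]_n.

(** Boxes with rational centre and radius 1 / (k + 1): a countable base of the topology. *)
Definition rat_box (p : 'rV[rat]_n * nat) : set V :=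
  [set v | forall i, `|v 0 i - ratr (p.1 0 i)| < p.2.+1%:R^-1].

Lemma cvg_rV (T : Type) (F : set_system T) (FF : Filter F) (f : T -> V)
  (a : V) :
  (forall i, f t 0 i @[t --> F] --> a 0 i) -> f @ F --> a.
Proof.
move=> fa; apply/cvgrPdist_lt => e e0.
have : \forall t \near F, forall i, `|a 0 i - f t 0 i| < e.
  by apply: filter_forall => i; move/cvgrPdist_lt: (fa i); apply.
apply: filterS => t at_.
rewrite [X in X < _](_ : _ = mx_norm (a - f t))// mx_normrE.
by apply/bigmax_ltP; split=> // -[i j] _ /=; rewrite !mxE ord1.
Qed.

Lemma continuous_rV (T : topologicalType) (f : T -> V) :
  (forall i, continuous (fun t => f t 0 i)) -> continuous f.
Proof. by move=> cf t; apply: cvg_rV => i; exact: cf. Qed.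

Lemma open_rat_box p : open (rat_box p).
Proof.
rewrite openE => v bv.
suff : nbhs v [set u : V | forall i, `|u 0 i - ratr (p.1 0 i)| < p.2.+1%:R^-1]
  by [].
apply: (@filter_forall _ _ (fun i (u : V) => `|u 0 i - ratr (p.1 0 i)| <
  p.2.+1%:R^-1) (nbhs v) _) => i.
pose g (u : V) := `|u 0 i - ratr (p.1 0 i)|.
have cg : {for v, continuous g}.
  apply: (@continuous_comp _ _ _ (fun u : V => u 0 i)
    (fun t : R => `|t - ratr (p.1 0 i)|)); first exact: coord_continuous.
  by apply: cvg_norm; apply: cvgB; [exact: cvg_id|exact: cvg_cst].
exact: cg (lt_nbhsl (bv i)).
Qed.

Lemma rat_box_nbhs (v : V) (A : set V) : nbhs v A ->
  exists2 p, rat_box p v & rat_box p `<=` A.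
Proof.
move=> /nbhs_ballP[e /= e0 eA].
have [k ke] : exists k : nat, k.+1%:R^-1 < e / 2.
  exists (Num.truncn (e / 2)^-1).
  by rewrite invf_plt ?posrE ?divr_gt0//; exact: truncnS_gt.
have : 0 < k.+1%:R^-1 :> R by rewrite invr_gt0.
rewrite /rat_box /=; move: ke; set d := k.+1%:R^-1 => ke d0.
have /choice[c cv] i : exists q : rat, `|v 0 i - ratr q| < d.
  have [|q] := @rat_in_itvoo R (v 0 i - d) (v 0 i + d).
    by lra.
  by rewrite in_itv /= => /andP[? ?]; exists q; rewrite ltr_norml; lra.
exists (\row_i c i, k); first by move=> i; rewrite /= mxE; exact: cv.
move=> u uc.
apply: eA; split=> // i j; rewrite ord1 /ball /=.
have := cv j; have := uc j; rewrite /= mxE -/d !ltr_norml.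
by move=> /andP[? ?] /andP[? ?]; apply/andP; split; lra.
Qed.

Lemma rV_second_countable : @second_countable V.
Proof.
exists [set rat_box p | p in [set: 'rV[rat]_n * nat]].
  by apply: sub_countable (card_image_le _ _) _; exact: countableP.
split=> [_ [p _ <-]|x A]; first exact: open_rat_box.
move=> /rat_box_nbhs[p px pA]; exists (rat_box p) => //.
Qed.

Lemma open_bigcup_rat_box (U : set V) : open U ->
  U = \bigcup_(p in [set p | rat_box p `<=` U]) rat_box p.
Proof.
move=> oU; apply/seteqP; split=> [v Uv|v [p pU /pU]//].
have [p pv pU] : exists2 p, rat_box p v & rat_box p `<=` U.
  by apply: rat_box_nbhs; rewrite openE in oU; exact: oU.
by exists p.
Qed.

Lemma compact_box (a b : R) :
  compact [set v : V | forall i, `[a, b]%classic (v 0 i)].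
Proof.
apply: (@rV_compact _ _ (fun=> `[a, b]%classic)) => i; exact: segment_compact.
Qed.

Lemma nbhs_box (v : V) : nbhs v
  [set u : V | forall i, `[v 0 i - 1, v 0 i + 1]%classic (u 0 i)].
Proof.
apply/nbhs_ballP; exists 1 => //= u [_ uv] i /=.
have := uv 0 i; rewrite /ball /= ltr_norml in_itv /= => /andP[? ?].
by apply/andP; split; lra.
Qed.

Lemma rV_locally_compact : locally_compact [set: V].
Proof.
move=> v _.
exists [set u : V | forall i, `[v 0 i - 1, v 0 i + 1]%classic (u 0 i)].
  by apply: filterS (nbhs_box v) => u uv _.
have cpt : compact
  [set u : V | forall i, `[v 0 i - 1, v 0 i + 1]%classic (u 0 i)].
  apply: (@rV_compact _ _ (fun i => `[v 0 i - 1, v 0 i + 1]%classic)) => i.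
  exact: segment_compact.
by split=> //; apply: compact_closed cpt; exact: norm_hausdorff.
Qed.

Definition borel_rV := g_sigma_algebraType (@open V).

(** An open set is a countable union of rational boxes, and each box is a finite intersection of
    conditions on single coordinates. *)
Lemma measurable_fun_rV d (T : measurableType d) (f : T -> borel_rV) :
  (forall i, measurable_fun setT (fun t => (f t : V) 0 i)) ->
  measurable_fun setT f.
Proof.
move=> mf; apply: (@measurability _ _ _ borel_rV setT f (@open V)) => // _
  [U oU <-].
rewrite setTI (open_bigcup_rat_box oU) preimage_bigcup.
rewrite bigcup_mkcond; apply: countable_bigcupT_measurable => // p.
case: ifPn => // _.
rewrite (_ : _ @^-1` _ = \bigcap_(i in [set: 'I_n])
    ((fun t => (f t : V) 0 i) @^-1`
       [set r : R | `|r - ratr (p.1 0 i)| < p.2.+1%:R^-1])); last first.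
  by apply/seteqP; split=> t /= H i => [_|]; apply: H.
apply: fin_bigcap_measurable => // i _.
rewrite -[X in measurable X]setTI; apply: (mf i) => //.
apply: open_measurable;
  rewrite (_ : [set r | _] = ball (ratr (p.1 0 i) : R) p.2.+1%:R^-1).
  exact: ball_open.
by apply/seteqP; split=> r; rewrite /ball /= distrC.
Qed.

End row_vector_topology.

(** * Iterated skew products of rotations *)

Section rotation.
Variable R : realType.
Local Notation mu := (@lebesgue_measure R).
Local Open Scope ereal_scope.

(** The pushforward by a translation agrees with Lebesgue measure on the half-open intervals, which
    determine the latter. *)
Lemma lebesgue_measure_shift (c : R) (A : set R) : measurable A ->
  mu ((fun t => t + c)%R @^-1` A) = mu A.
Proof.
have mc : measurable_fun [set: R] (fun t : R => t + c)%R.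
  exact: measurable_funD.
move=> mA; apply/esym.
pose f (t : R) : measurableTypeR R := (t + c)%R.
have mf : measurable_fun setT f by exact: mc.
rewrite (@lebesgue_measure_unique _
  (measure_function_pushforward__canonical__measure_function_Measure mu
  mf))// => _ [[a b] _ <-].
rewrite /= /pushforward /=.
rewrite (_ : f @^-1` _ = `]a - c, b - c]%classic)%R; last first.
  by apply/seteqP; split=> t /=; rewrite /f !in_itv /= ltrBlDr lerBrDr.
rewrite !lebesgue_measure_itv /= !lte_fin ltrBlDr subrK; case: ifP => // _.
by rewrite -!EFinB; congr EFin; lra.
Qed.

Local Close Scope ereal_scope.
Definition frac_part (t : R) : R := t - (Num.floor t)%:~R.

Lemma frac_part_itv t : 0 <= frac_part t < 1.
Proof.
rewrite /frac_part; have /andP[] := floor_itv t; rewrite intrD => ? ?.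
by apply/andP; split; lra.
Qed.

Lemma frac_part_id t : 0 <= t < 1 -> frac_part t = t.
Proof. by move=> t01; rewrite /frac_part (@floor_def _ t 0) ?subr0. Qed.

Lemma frac_part_eq (s t : R) : s - t \is a Num.int -> frac_part s = frac_part t.
Proof.
move=> st; rewrite -(subrK t s) /frac_part floorDzr// intrD floorK//.
by rewrite opprD addrACA subrr add0r.
Qed.

Lemma measurable_floor : measurable_fun setT
  (fun t : R => (Num.floor t)%:~R : R).
Proof.
apply: nondecreasing_measurable => //.
by move=> s t st; rewrite ler_int; exact: le_floor.
Qed.

(** The Haar probability of R/Z, carried by the fundamental domain [0, 1[ and seen as a measure on
    R. *)
Definition unit_lebesgue : set (measurableTypeR R) -> \bar R :=
  mrestr mu (measurable_itv `[0, 1[).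

HB.instance Definition _ := Measure.on unit_lebesgue.

Let unit_lebesgueT : unit_lebesgue setT = 1%E.
Proof.
by rewrite /unit_lebesgue /mrestr setTI /= lebesgue_measure_itv /= lte01 sube0.
Qed.

HB.instance Definition _ :=
  @Measure_isProbability.Build _ _ R unit_lebesgue unit_lebesgueT.

Lemma unit_lebesgue_rotation (c : R) (A : set R) : measurable A ->
  unit_lebesgue ((fun t => frac_part (t + c)) @^-1` A) = unit_lebesgue A.
Proof.
move=> mA; wlog c01 : c / 0 <= c < 1.
  move=> /(_ (frac_part c) (frac_part_itv c)) <-; congr (unit_lebesgue _).
  apply/seteqP; split=> t /=;
    rewrite (@frac_part_eq (t + c) (t + frac_part c))//;
  by rewrite /frac_part (_ : _ - _ = (Num.floor c)%:~R) ?intr_int//; lra.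
have /andP[c0 c1] := c01.
rewrite /unit_lebesgue /mrestr.
(* The rotation by c is an exchange of two intervals: [0, 1 - c[ is translated by c onto [c, 1[, and
   [1 - c, 1[ by c - 1 onto [0, c[. *)
rewrite (_ : _ `&` _ = ((fun t => t + c) @^-1` (A `&` `[c, 1[)) `|`
   ((fun t => t + (c - 1)) @^-1` (A `&` `[0, c[))); last first.
  apply/seteqP; split=> t /=.
    rewrite !in_itv /= => -[At /andP[t0 t1]].
    have [tc|tc] := ltP (t + c) 1.
      left; rewrite frac_part_id in At; first by split=> //; apply/andP; split;
        lra.
      by apply/andP; split; lra.
    right; split; last by apply/andP; split; lra.
    rewrite (@frac_part_eq _ (t + (c - 1))) ?frac_part_id in At => //.
      by apply/andP; split; lra.
    by rewrite (_ : _ - _ = 1)//; lra.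
  rewrite !in_itv /=; case=> -[At /andP[t0 t1]].
    split; last by apply/andP; split; lra.
    by rewrite frac_part_id//; apply/andP; split; lra.
  split; last by apply/andP; split; lra.
  rewrite (@frac_part_eq _ (t + (c - 1))) ?frac_part_id//; first by apply/andP;
    split; lra.
  by rewrite (_ : _ - _ = 1)//; lra.
have mI (a b : R) : measurable (A `&` `[a, b[) by exact: measurableI.
have mS (a : R) B : measurable B -> measurable ((fun t : R => t + a) @^-1` B).
  by move=> mB; rewrite -[X in measurable X]setTI; exact: measurable_funD.
rewrite measureU; [|exact: mS|exact: mS|]; last first.
  apply/seteqP; split=> t //=; rewrite !in_itv /=.
  by move=> [[_ /andP[? ?]] [_ /andP[? ?]]]; lra.
transitivity (mu (A `&` `[c, 1%R[) + mu (A `&` `[0%R, c[))%E.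
  by congr (_ + _)%E; exact: lebesgue_measure_shift.
have <- : mu ((A `&` `[c, 1%R[) `|` (A `&` `[0%R, c[)) =
    (mu (A `&` `[c, 1%R[) + mu (A `&` `[0%R, c[))%E.
  rewrite measureU; [by []|exact: mI|exact: mI|].
  apply/seteqP; split=> t //=; rewrite !in_itv /=.
  by move=> [[_ /andP[? ?]] [_ /andP[? ?]]]; lra.
rewrite -setIUr
  (_ : (`[c, 1[ `|` `[0, c[)%classic = `[0, 1[%classic :> set R)//.
apply/seteqP; split=> t /=; rewrite !in_itv /=.
  by case=> /andP[? ?]; apply/andP; split; lra.
by move=> /andP[? ?]; case: (ltP t c) => ?; [right|left]; apply/andP; split;
  lra.
Qed.

End rotation.

Lemma g_sigma_open_measurable (R : realType) (T : ptopologicalType)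
    (f : T -> R) : continuous f ->
  measurable_fun setT (f : g_sigma_algebraType (@open T) -> R).
Proof.
move=> cf; apply: (measurability _ (RGenOpens.measurableE R)).
move=> _ [_ [a [b ->]] <-]; rewrite setTI; apply: sub_sigma_algebra.
by apply: open_comp => [x _|]; [exact: cf|exact: interval_open].
Qed.

Section skew_product.
Variables (R : realType) (n : nat) (w : 'I_n -> nat).
Local Notation V := 'rV[R]_n.
Local Notation M := (borel_rV R n).

Lemma measurable_coord (i : 'I_n) :
  measurable_fun setT (fun x : M => (x : V) 0 i).
Proof. by apply: g_sigma_open_measurable; exact: coord_continuous. Qed.

Definition axis_shift (j : 'I_n) (p : M * measurableTypeR R) : M :=
  (p.1 : V) + (p.2 : R) *: delta_mx 0 j.

Lemma measurable_axis_shift j : measurable_fun setT (axis_shift j).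
Proof.
apply: measurable_fun_rV => i; rewrite /axis_shift.
under eq_fun do rewrite !mxE.
apply: measurable_funD.
  exact: (measurableT_comp (measurable_coord i) measurable_fst).
by apply: measurable_funM => //; exact: measurable_snd.
Qed.

Section extend.
Variables (P : probability M R) (j : 'I_n).

(** The law of x + t e_j, with x of law P and t independent and uniform on [0, 1[. *)
Definition axis_extend : set M -> \bar R :=
  pushforward (P \x @unit_lebesgue R)%E (axis_shift j).

HB.instance Definition _ := Measure.copy axis_extend
  (measure_function_pushforward__canonical__measure_function_Measure
    (P \x @unit_lebesgue R)%E (measurable_axis_shift j)).

Let axis_extendT : axis_extend setT = 1%E.
Proof.
rewrite /axis_extend /pushforward preimage_setT -setXTT product_measure1E//.
by rewrite -[RHS]mule1; congr (_ * _)%E; exact: probability_setT.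
Qed.

HB.instance Definition _ :=
  @Measure_isProbability.Build _ _ R axis_extend axis_extendT.
End extend.

(** Modulo Z, T rotates the i-th coordinate by an angle that depends only on the coordinates of
    lower weight. The second clause, an exact equality, makes the property stable under
    composition. *)
Definition unitriangular_mod1 (T : V -> V) : Prop :=
  forall i (x y : V), (forall j, (w j < w i)%N -> x 0 j = y 0 j) ->
  (T x 0 i - x 0 i) - (T y 0 i - y 0 i) \is a Num.int /\
  (x 0 i = y 0 i -> T x 0 i = T y 0 i).

Definition truncation (s : seq 'I_n) (x : V) : V :=
  \row_i (if i \in s then x 0 i else 0).

Lemma measurable_truncation s : measurable_fun setT (truncation s : M -> M).
Proof.
apply: measurable_fun_rV => i; under eq_fun do rewrite mxE.
by case: (i \in s); [exact: (measurable_coord i)|exact: measurable_cst].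
Qed.

(* Modulo Z, the coordinates of T taken in the order of s form an iterated skew
   product of rotations. *)
Lemma skew_product_measure (s : seq 'I_n) :
  uniq s -> pairwise (fun j i => w i <= w j)%N s ->
  exists P : probability M R, forall T : M -> M,
    measurable_fun setT T -> unitriangular_mod1 T ->
    (forall (x : M) i, i \in s -> 0 <= (T x : V) 0 i < 1) ->
    forall A : set M, measurable A -> P ((truncation s \o T) @^-1` A) = P A.
Proof.
(* The weights decrease along the list, so the head j is the last rotation of the skew product. For
   the empty list the truncation is constantly 0, and a Dirac mass works. *)
elim: s => [_ _|j s IH /=/andP[js us] /andP[js_w s_w]].
  exists (dirac (0 : M)) => T _ _ _ A _.
  have t0 : truncation [::] (T 0) = 0 by apply/rowP => i; rewrite !mxE.
  rewrite [LHS]diracE [RHS]diracE; congr ((nat_of_bool _)%:R%:E).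
  by apply/idP/idP; rewrite !inE /= t0.
have [P PT] := IH us s_w; exists (axis_extend P j) => T mT uT T01 A mA.
have mjA : measurable (axis_shift j @^-1` A).
  by rewrite -[X in measurable X]setTI; exact: measurable_axis_shift.
(* [F] measures the fibre of A over y in the direction of e_j; integrating it against P gives the
   extended measure of A. *)
pose F (y : M) := @unit_lebesgue R (xsection (axis_shift j @^-1` A) y).
have mF : measurable_fun setT F by exact: measurable_fun_xsection.
rewrite /axis_extend /pushforward /product_measure1.
transitivity (\int[P]_x (F \o (truncation s \o T)) x)%E.
  apply: eq_integral => x _ /=.
  have mx : measurable (xsection (axis_shift j @^-1` A)
    (truncation s (T x) : M)).
    exact: measurable_xsection.
  rewrite /F -(unit_lebesgue_rotation ((T x : V) 0 j) mx).
  congr (@unit_lebesgue R _); apply/seteqP.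
  (* Adding t e_j to x leaves the coordinates of T x in s unchanged and adds t modulo Z to the j-th
     one. So T acts on the fibre as a rotation, which preserves its measure. *)
  suff e t : truncation (j :: s) (T (axis_shift j (x, t))) =
      axis_shift j (truncation s (T x), frac_part (t + (T x : V) 0 j)).
    by split=> t; rewrite /xsection/= !inE /= e.
  have agree k i : (w k < w i)%N -> (w i <= w j)%N ->
      (axis_shift j (x, t) : V) 0 k = (x : V) 0 k.
    move=> ki ij; rewrite !mxE (_ : k == j = false) ?andbF ?mulr0 ?addr0//.
    by apply/negbTE/eqP => kj; move: (leq_trans ki ij); rewrite kj ltnn.
  apply/rowP => i; rewrite ![in LHS]mxE ![in RHS]mxE inE /=.
  have [->|ij] := eqVneq i j.
    rewrite (negbTE js) /= add0r mulr1.
    have [] := uT j (axis_shift j (x, t)) x => [k kj|];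
      first exact: (agree k j).
    rewrite ![in X in X -> _]mxE /= eqxx mulr1 => h _.
    rewrite -[LHS]frac_part_id ?T01 ?inE ?eqxx//; apply: frac_part_eq.
    by move: h; congr (_ \is a _); ring.
  rewrite /= mulr0 addr0; case: ifPn => // si.
  have wij : (w i <= w j)%N by move/allP : js_w; apply.
  have [k ki|_] := uT i (axis_shift j (x, t)) x; first exact: (agree k i).
  by apply; rewrite !mxE /= (negbTE ij) mulr0 addr0.
pose S : M -> M := truncation s \o T.
have mS : measurable_fun setT S.
  by apply: measurableT_comp => //; exact: measurable_truncation.
have F0 y : (0 <= F y)%E by exact: measure_ge0.
(* It remains to integrate [F] against the pushforward of P by [S], which is P by induction. *)
have := @ge0_integral_pushforward _ _ M M R S mS P setT F measurableT.
rewrite preimage_setT => <- //.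
apply: eq_measure_integral => B mB _.
apply: PT => // x i si; apply: T01; by rewrite inE si orbT.
Qed.

End skew_product.

(** * Uniform lattices in triangular groups *)

Lemma continuous_mulg (G : topologicalGroupType) (T : topologicalType)
    (f g : T -> G) : continuous f -> continuous g ->
  continuous (fun t => f t * g t)%g.
Proof.
move=> cf cg t.
apply: (@continuous2_cvg _ _ _ _ _ _ f g (fun a b => a * b)%g).
- exact: (@mulg_continuous G (f t, g t)).
- exact: cf.
- exact: cg.
Qed.

Section triangular_lattice.
Variables (R : realType) (G : topologicalGroupType) (n : nat) (w : 'I_n -> nat).
Local Notation V := 'rV[R]_n.
Local Notation M := (borel_rV R n).
Variables (theta : V -> G) (eta : G -> V).
Hypotheses (theta_cont : continuous theta) (eta_cont : continuous eta)
  (thetaK : cancel theta eta) (etaK : cancel eta theta)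
    (theta0 : theta 0 = 1%g).

Local Notation mul x y := (eta (theta x * theta y)%g).

Hypothesis mul_triangular : forall (x x' y y' : V) i,
  (forall j, (w j < w i)%N -> x 0 j = x' 0 j /\ y 0 j = y' 0 j) ->
  mul x y 0 i - x 0 i - y 0 i = mul x' y' 0 i - x' 0 i - y' 0 i.

Definition integral_rV : set V := [set x | forall i, x 0 i \is a Num.int].

Hypotheses (integral_mul : forall x y, integral_rV x -> integral_rV y ->
    integral_rV (mul x y))
  (integral_inv : forall x, integral_rV x -> integral_rV (eta (theta x)^-1%g)).

Let Gamma : set G := theta @` integral_rV.

Let Gamma_group : group_closed [in Gamma].
Proof.
split.
  by rewrite in_setE; exists 0 => // i; rewrite mxE.
move=> x y; rewrite !in_setE => -[u iu <-] [v iv <-].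
exists (mul u (eta (theta v)^-1)); last by rewrite !etaK.
by apply: integral_mul => //; exact: integral_inv.
Qed.

Let Gamma_discrete : discrete_subgroup Gamma.
Proof.
split=> // _ [x ix <-]; split; first by rewrite in_setE; exists x.
exists (eta @^-1` ball x 1).
  by apply: eta_cont; rewrite thetaK; exact: nbhsx_ballx.
apply/seteqP; split=> [_ [/[swap] -[y iy <-]]|_ ->] /=; last first.
  by split; [rewrite thetaK; exact: ballxx|exists x].
rewrite thetaK => -[_ xy]; congr theta; apply/rowP => i.
have := xy 0 i; rewrite /ball /= => xyi.
apply/eqP; rewrite eq_sym -subr_eq0 -(@floorK R (x 0 i - y 0 i)) ?rpredB//
  intr_eq0.
move: xyi; rewrite -{1}(@floorK R (x 0 i - y 0 i)) ?rpredB//.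
by rewrite -intr_norm -[X in _ < X]/(1%:~R) ltr_int -[1]add0r ltzD1 normr_le0.
Qed.

(** Right multiplication by a lattice element, so the coset is kept. The j-th coordinate is replaced
    by its fractional part, and the other coordinates of weight at most that of j are unchanged. *)
Definition reduce (j : 'I_n) (x : V) : V :=
  mul x (- (Num.floor (x 0 j))%:~R *: delta_mx 0 j).

Definition reduction (s : seq 'I_n) (x : V) : V := foldr reduce x s.

(** Comparison of y with 0 in [mul_triangular]. *)
Let mul_tail (x y : V) i : (forall j, (w j < w i)%N -> y 0 j = 0) ->
  mul x y 0 i = x 0 i + y 0 i.
Proof.
move=> y0; have := @mul_triangular x x y 0 i.
rewrite theta0 mulg1 thetaK mxE subr0 subrr => h.
apply/eqP; rewrite -subr_eq0 opprD addrA; apply/eqP; apply: h => j ji.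
by rewrite y0// mxE.
Qed.

Lemma reduce_coset j x :
  (\pi_(coset_space Gamma) (theta (reduce j x)) = \pi_(coset_space Gamma)
    (theta x))%qT.
Proof.
rewrite /reduce etaK; apply: coset_mulr => //.
exists (- (Num.floor (x 0 j))%:~R *: delta_mx 0 j) => // i.
rewrite !mxE; case: (_ && _) => /=; last by rewrite mulr0 int_num0.
by rewrite mulr1 rpredN intr_int.
Qed.

Lemma reduction_coset s x :
  (\pi_(coset_space Gamma) (theta (reduction s x)) = \pi_(coset_space Gamma)
    (theta x))%qT.
Proof. by elim: s => //= j s IH; rewrite reduce_coset. Qed.

(** [foldr] treats the end of the list first, that is the lowest weights, and a later reduction does
    not disturb the coordinates already reduced. *)
Lemma reduction_itv s : pairwise (fun j i => w i <= w j)%N s ->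
  forall x i, i \in s -> 0 <= reduction s x 0 i < 1.
Proof.
elim: s => //= j s IH /andP[js /IH{}IH] x i.
set y := reduction s x; have e k : (w k <= w j)%N ->
    reduce j y 0 k = y 0 k + (- (Num.floor (y 0 j))%:~R *: delta_mx 0 j : V) 0
      k.
  move=> kj; apply: mul_tail => l lk; rewrite !mxE (_ : l == j = false).
    by rewrite andbF mulr0.
  by apply/negbTE/eqP => lj; move: (leq_trans lk kj); rewrite lj ltnn.
rewrite inE; have [-> _|ij /= si] := eqVneq i j.
  by rewrite e// !mxE !eqxx mulr1; exact: frac_part_itv.
rewrite e; last by move/allP : js; apply.
by rewrite !mxE (negbTE ij) andbF mulr0 addr0; exact: IH.
Qed.

Lemma unitriangular_comp (S T : V -> V) : unitriangular_mod1 w S ->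
  unitriangular_mod1 w T -> unitriangular_mod1 w (S \o T).
Proof.
move=> uS uT i x y xy.
have Txy j : (w j < w i)%N -> T x 0 j = T y 0 j.
  move=> ji; apply: (uT j x y _).2; last exact: xy.
  by move=> k kj; apply: xy; exact: ltn_trans ji.
have [S1 S2] := uS i (T x) (T y) Txy; have [T1 T2] := uT i x y xy.
split=> /= [|/T2/S2//].
have -> : S (T x) 0 i - x 0 i - (S (T y) 0 i - y 0 i) =
  (S (T x) 0 i - T x 0 i - (S (T y) 0 i - T y 0 i)) +
  (T x 0 i - x 0 i - (T y 0 i - y 0 i)) by ring.
exact: rpredD.
Qed.

(** The lattice factor depends on x only through the integer part of x_j. If j has lower weight than
    i, the factors for x and y coincide; if i = j, their i-th coordinates differ by an integer. *)
Lemma unitriangular_reduce j : unitriangular_mod1 w (reduce j).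
Proof.
move=> i x y xy; rewrite /reduce.
set a : V := _ *: _; set b : V := _ *: _.
have ab : forall k, (w k < w i)%N -> a 0 k = b 0 k.
  move=> k ki; rewrite !mxE; have [kj|] := eqVneq k j;
    last by rewrite andbF !mulr0.
  by rewrite -kj xy.
have := @mul_triangular x y a b i.
set u := mul x a;
  set v := mul y b => /(_ (fun k ki => conj (xy k ki) (ab k ki))) uv.
have -> : u 0 i - x 0 i - (v 0 i - y 0 i) = a 0 i - b 0 i.
  by apply/eqP; rewrite -subr_eq0; apply/eqP; move: uv => /eqP;
    rewrite -subr_eq0 => /eqP <-; ring.
split.
  rewrite !mxE; case: (_ && _) => /=; last by rewrite !mulr0 subrr int_num0.
  by rewrite !mulr1; apply: rpredB; rewrite rpredN intr_int.
move=> xyi; have abi : a 0 i = b 0 i.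
  rewrite !mxE; have [ij|] := eqVneq i j; last by rewrite andbF !mulr0.
  by rewrite -ij xyi.
by move: uv; rewrite xyi abi => /addIr/addIr.
Qed.

Lemma unitriangular_reduction s : unitriangular_mod1 w (reduction s).
Proof.
elim: s => [|j s IH]; last
  exact: (unitriangular_comp (unitriangular_reduce j) IH).
by move=> i x y _; rewrite /reduction /= !subrr.
Qed.

Lemma unitriangular_mull g :
  unitriangular_mod1 w (fun x => eta (g * theta x)%g).
Proof.
move=> i x y xy; have := @mul_triangular (eta g) (eta g) x y i.
rewrite etaK => h.
have {}h : eta (g * theta x)%g 0 i - x 0 i = eta (g * theta y)%g 0 i - y 0 i.
  have /eqP := h (fun j ji => conj erefl (xy j ji)).
  rewrite -subr_eq0 => /eqP h'; apply/eqP; rewrite -subr_eq0; apply/eqP.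
  by rewrite -h'; ring.
rewrite h subrr; split=> // xyi.
by move: h; rewrite xyi => /addIr.
Qed.

Lemma measurable_continuous (f : V -> V) : continuous f ->
  measurable_fun setT (f : M -> M).
Proof.
move=> cf; apply: (@measurability _ _ M M setT f (@open V)) => // _ [U oU <-].
rewrite setTI; apply: sub_sigma_algebra; apply: open_comp => // x _; exact: cf.
Qed.

Let mul_cont g h : continuous (fun x => eta (g * theta x * h)%g).
Proof.
move=> x; apply: continuous_comp; last exact: eta_cont.
apply: (continuous_mulg _ (@cst_continuous _ _ h)).
exact: (continuous_mulg (@cst_continuous _ _ g)).
Qed.

(** On each of the countably many measurable sets where the integer part of x_j is constant,
    [reduce] agrees with a continuous map. *)
Lemma measurable_reduce j : measurable_fun setT (reduce j : M -> M).
Proof.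
apply: (@measurability _ _ M M setT (reduce j) (@open V)) => // _ [U oU <-].
pose f (c : int) (x : M) : M := mul x (- c%:~R *: delta_mx 0 j).
rewrite setTI (_ : _ @^-1` _ = \bigcup_c
   ((fun x : M => (Num.floor ((x : V) 0 j))%:~R : R) @^-1` [set c%:~R] `&`
    f c @^-1` U)); last first.
  apply/seteqP; split=> [x Ux|x [c _ [/= /intr_inj <-//]]].
  by exists (Num.floor ((x : V) 0 j)).
apply: countable_bigcupT_measurable => [|c]; first exact: countableP.
apply: measurableI.
  rewrite -[X in measurable X]setTI.
  have mf : measurable_fun setT
    (fun x : M => (Num.floor ((x : V) 0 j))%:~R : R).
    exact: (measurableT_comp (@measurable_floor R) (measurable_coord j)).
  exact: mf.
rewrite -[X in measurable X]setTI.
apply: (@measurable_continuous (f c)) => //; last exact: sub_sigma_algebra.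
have := @mul_cont 1%g (theta (- c%:~R *: delta_mx 0 j)).
by under eq_fun do rewrite mul1g.
Qed.

Lemma measurable_reduction s : measurable_fun setT (reduction s : M -> M).
Proof.
elim: s => [|j s IH]; first exact: measurable_id.
exact: (measurableT_comp (measurable_reduce j) IH).
Qed.

Let proj (x : V) : coset_space Gamma := (\pi_(coset_space Gamma) (theta x))%qT.

Let proj_cont : continuous proj.
Proof.
by move=> x; apply: continuous_comp; [exact: theta_cont|exact: pi_continuous].
Qed.

(** All coordinates, by decreasing weight. *)
Let weight_order := sort (fun j i => w i <= w j)%N (enum 'I_n).

Let pairwise_weight_order : pairwise (fun j i => w i <= w j)%N weight_order.
Proof.
rewrite -sorted_pairwise; last by move=> i j k ij ki; exact: leq_trans ki ij.
by apply: sort_sorted => i j; exact: leq_total.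
Qed.

Let mem_weight_order i : i \in weight_order.
Proof. by rewrite mem_sort mem_enum. Qed.

Let Gamma_compact : compact [set: coset_space Gamma].
Proof.
have -> : [set: coset_space Gamma] =
    proj @` [set v : V | forall i, `[0, 1]%classic (v 0 i)].
  apply/seteqP; split=> // q _; pose x := eta (repr q).
  exists (reduction weight_order x) => [i /=|].
    have /andP[h0 h1] := reduction_itv pairwise_weight_order x
      (mem_weight_order i).
    by rewrite in_itv /= h0 ltW.
  by rewrite /proj reduction_coset etaK reprK.
by apply: continuous_compact; [exact: continuous_subspaceT|exact: compact_box].
Qed.

(** The measure is the image of the skew product measure in the coset space. Left translation by g,
    read on reduced representatives, is the map [T] below, to which [skew_product_measure]
    applies. *)
Let Gamma_measure :
  exists mu : probability (borel_coset_space Gamma) R, invariant_probability mu.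
Proof.
have us : uniq weight_order by rewrite sort_uniq enum_uniq.
have [P PT] := skew_product_measure R us pairwise_weight_order.
have mproj : measurable_fun setT (proj : M -> borel_coset_space Gamma).
  apply: (@measurability _ _ M (borel_coset_space Gamma) setT proj
    (@open _)) => //.
  move=> _ [U oU <-]; rewrite setTI; apply: sub_sigma_algebra.
  by apply: open_comp => // x _; exact: proj_cont.
pose X : {mfun M >-> borel_coset_space Gamma} :=
  MeasurableFun.Pack (MeasurableFun.Class
    (isMeasurableFun.Build _ _ _ _ _ mproj)).
exists (distribution P X) => g A mA; rewrite /distribution /pushforward /=.
have mXA : measurable (proj @^-1` A : set M).
  by rewrite -[X0 in measurable X0]setTI; exact: (mproj measurableT _ mA).
pose T (x : M) : M := reduction weight_order (eta (g * theta x)%g).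
have key : P ((truncation weight_order \o T) @^-1` (proj @^-1` A)) = P
  (proj @^-1` A).
  apply: PT mXA; last first.
- by move=> x i _; exact: reduction_itv.
- exact: (unitriangular_comp (unitriangular_reduction _)
  (unitriangular_mull g)).
- apply: (measurableT_comp (measurable_reduction _)).
  apply: measurable_continuous; have := @mul_cont g 1%g.
  by under eq_fun do rewrite mulg1.
suff e x : proj (truncation weight_order (T x)) = coset_act g (proj x).
  have eA : proj @^-1` (coset_act g @^-1` A) =
      (truncation weight_order \o T) @^-1` (proj @^-1` A).
    by apply/seteqP; split=> x /=; rewrite e.
  exact: (etrans (congr1 P eA) key).
rewrite (_ : truncation _ _ = T x); last first.
  by apply/rowP => i; rewrite mxE mem_weight_order.
by rewrite /proj reduction_coset etaK coset_actE.
Qed.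

Theorem triangular_uniform_lattice : uniform_lattice R Gamma.
Proof. by split=> //; split. Qed.

End triangular_lattice.

(** * Minimal polynomials *)

Section minimal_polynomial.
Variables (R : realType) (lambda : R).
Hypothesis lambda_alg : algebraicOver (@ratr R) lambda.

(** Minimality of the degree stands for irreducibility in what follows. *)
Definition minimal_at (x : R) (p : {poly rat}) :=
  forall r : {poly rat}, r != 0 -> root (map_poly ratr r) x ->
  (size p <= size r)%N.

Lemma exists_minimal : exists p : {poly rat},
  [/\ p \is monic, root (map_poly ratr p) lambda & minimal_at lambda p].
Proof.
pose S (k : nat) := `[< exists p : {poly rat},
  [/\ p != 0, root (map_poly ratr p) lambda & size p = k] >].
have exS : exists k, S k.
  by have [p p0 pr] := lambda_alg; exists (size p); apply/asboolP; exists p.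
case: (ex_minnP exS) => k /asboolP[p [p0 pr pk]] k_min.
have lp0 : lead_coef p != 0 by rewrite lead_coef_eq0.
exists ((lead_coef p)^-1 *: p); split.
- by rewrite monicE lead_coefZ mulVf.
- by rewrite map_polyZ /= rootZ// fmorph_eq0 invr_eq0.
- move=> r r0 rr; rewrite size_scale ?invr_eq0// pk.
  by apply: k_min; apply/asboolP; exists r.
Qed.

Lemma algebraic_integer_multiple : exists (D : nat) (p : {poly rat}),
  [/\ (0 < D)%N, p \is monic, p \is a polyOver Num.int,
      root (map_poly ratr p) (D%:R * lambda) & minimal_at (D%:R * lambda) p].
Proof.
have [p [pmon pr pmin]] := exists_minimal.
(* A common denominator of the coefficients of p. *)
pose D : nat := (\prod_(i < size p) `|denq p`_i|)%N.
have D0 : (0 < D)%N by apply: prodn_gt0 => i; rewrite absz_gt0 denq_neq0.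
have Dq0 : D%:R != 0 :> rat by rewrite pnatr_eq0 -lt0n.
have Dint i : D%:R * p`_i \is a Num.int.
  have [ip|pi] := ltnP i (size p); last by rewrite nth_default// mulr0 int_num0.
  rewrite /D (bigD1 (Ordinal ip))//= natrM mulrAC.
  rewrite rpredM//; last exact: rpred_nat.
  rewrite mulrC -[X in X * _]divq_num_den.
  have -> : (`|denq p`_i|%N)%:R = (denq p`_i)%:~R :> rat.
    by rewrite -[LHS]/(`|denq p`_i|%N%:~R) gez0_abs// denq_ge0.
  by rewrite divfK ?intr_eq0 ?denq_neq0// intr_int.
pose d := (size p).-1.
have szp : size p = d.+1 by rewrite prednK// size_poly_gt0 monic_neq0.
(* P(X) = D ^ d * p(X / D) *)
pose P := \poly_(i < d.+1) (D%:R ^+ (d - i) * p`_i).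
have pd1 : p`_d = 1 by have := monicP pmon; rewrite lead_coefE.
have szP : size P = d.+1 by rewrite size_poly_eq// subnn mul1r pd1 oner_neq0.
exists D, P; split=> //.
- by rewrite monicE lead_coefE szP coef_poly ltnSn subnn mul1r pd1.
- apply/polyOverP => i; rewrite coef_poly; case: ltnP => id; last exact: rpred0.
  move: id; rewrite ltnS leq_eqVlt => /predU1P[->|id].
    by rewrite subnn mul1r pd1 rpred1.
  rewrite -[(d - i)%N]prednK ?subn_gt0// exprSr -mulrA rpredM//.
  by rewrite rpredX// rpred_nat.
- move: pr; rewrite /root !horner_coef !size_map_poly szP szp => /eqP pr.
  rewrite (eq_bigr (fun i : 'I_d.+1 => D%:R ^+ d *
    ((map_poly ratr p)`_i * lambda ^+ i))).
    by rewrite -mulr_sumr pr mulr0.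
  move=> i _; rewrite !coef_map /= coef_poly ltn_ord rmorphM rmorphXn /=
    ratr_nat.
  by rewrite exprMn mulrACA -exprD subnK // -ltnS.
(* If r vanishes at D lambda, then r(D X) has the same degree and vanishes at lambda, so minimality
   of p applies. *)
move=> r r0 rr; rewrite szP -szp.
have s2 : size (D%:R *: 'X : {poly rat}) = 2 by rewrite size_scale// size_polyX.
rewrite -(size_comp_poly2 r s2); apply: pmin.
  by rewrite -size_poly_eq0 size_comp_poly2// size_poly_eq0.
by rewrite /root map_comp_poly horner_comp map_polyZ /= map_polyX !hornerE
  ratr_nat.
Qed.
End minimal_polynomial.

Section integer_polynomials.
Variable R : realType.
Implicit Types a p u : {poly R}.

Lemma polyOver_int_ratr a : a \is a polyOver Num.int ->
  exists b : {poly rat}, a = map_poly ratr b.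
Proof.
move=> /floorpP[b ->]; exists (map_poly intr b).
by apply/polyP => i; rewrite !coef_map /= ratr_int.
Qed.

(** Division by a monic polynomial can be carried out over Z, and uniqueness of the remainder
    identifies it with the one over R. *)
Lemma modp_int u p : p \is monic -> p \is a polyOver Num.int ->
  u \is a polyOver Num.int -> u %% p \is a polyOver Num.int.
Proof.
move=> pmon /floorpP[p' pE] /floorpP[u' ->].
have injZ : injective (intr : int -> R) by exact: intr_inj.
have p'mon : p' \is monic.
  by move: pmon; rewrite pE !monicE lead_coef_map_inj// -(inj_eq injZ).
have e := Pdiv.RingMonic.rdivp_eq p'mon u'.
rewrite {1}e rmorphD rmorphM /= -pE modp_addl_mul_small.
  by apply/polyOverP => i; rewrite coef_map intr_int.
rewrite pE !size_map_inj_poly//; apply: Pdiv.Ring.ltn_rmodpN0.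
exact: monic_neq0.
Qed.

End integer_polynomials.

(* [Num.int] being a qualifier, [polyOver Num.int] has no inferred subring
   structure. *)
Section int_polynomials_subring.
Variable R : realType.
Implicit Types p r : {poly R}.

Lemma int_polyD p r : p \is a polyOver Num.int -> r \is a polyOver Num.int ->
  p + r \is a polyOver Num.int.
Proof.
by move=> /polyOverP pi /polyOverP ri; apply/polyOverP => i;
  rewrite coefD rpredD.
Qed.

Lemma int_polyN p : p \is a polyOver Num.int -> - p \is a polyOver Num.int.
Proof. by move=> /polyOverP pi; apply/polyOverP => i; rewrite coefN rpredN. Qed.

Lemma int_polyB p r : p \is a polyOver Num.int -> r \is a polyOver Num.int ->
  p - r \is a polyOver Num.int.
Proof. by move=> pi ri; apply: int_polyD => //; exact: int_polyN. Qed.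

Lemma int_polyM p r : p \is a polyOver Num.int -> r \is a polyOver Num.int ->
  p * r \is a polyOver Num.int.
Proof.
move=> /polyOverP pi /polyOverP ri; apply/polyOverP => i; rewrite coefM.
by apply: rpred_sum => j _; rewrite rpredM.
Qed.

Lemma int_polyC (a : R) : a \is a Num.int -> a%:P \is a polyOver Num.int.
Proof.
by move=> ai; apply/polyOverP => i; rewrite coefC; case: ifP => // _;
  exact: rpred0.
Qed.

Lemma int_polyX : ('X : {poly R}) \is a polyOver Num.int.
Proof. by apply/polyOverP => i; rewrite coefX rpred_nat. Qed.

End int_polynomials_subring.

Section minimal_factor.
Variables (R : realType) (mu : R) (p : {poly rat}).
Hypotheses (p_monic : p \is monic) (p_root : root (map_poly ratr p) mu)
  (p_min : minimal_at mu p).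
Local Notation pR := (map_poly (@ratr R) p).

(** The derivative is non-zero of smaller degree, so it cannot vanish at mu by minimality: mu is a
    simple root. *)
Let p_deriv : pR^`().[mu] != 0.
Proof.
rewrite deriv_map; apply/negP => rp'.
have sp : (1 < size p)%N.
  by rewrite -(size_map_poly (ratr : {rmorphism rat -> R}));
    apply: root_size_gt1 p_root;
    rewrite map_poly_eq0 monic_neq0.
have p'0 : p^`() != 0.
  apply/eqP => /polyP/(_ (size p).-2);
    rewrite coef_deriv coef0 prednK ?ltn_predRL//.
  move/eqP; rewrite -lead_coefE (monicP p_monic) pnatr_eq0.
  by case: (size p) sp => [|[]].
by have := lt_size_deriv (monic_neq0 p_monic); rewrite ltnNge p_min.
Qed.

Lemma minimal_coprime (a : {poly R}) : a \is a polyOver Num.int -> a != 0 ->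
  (size a < size p)%N -> coprimep a pR.
Proof.
move=> /polyOver_int_ratr[b ->]; rewrite map_poly_eq0 size_map_poly => b0 bp.
rewrite coprimep_map /coprimep; set g := gcdp b p.
have /dvdpP[h ph] : g %| p by exact: dvdp_gcdr.
have p0 := monic_neq0 p_monic.
have h0 : h != 0 by apply: contraNneq p0 => h0; rewrite ph h0 mul0r.
have g0 : g != 0 by apply: contraNneq p0 => g0; rewrite ph g0 mulr0.
(* mu is a root of h or of g. If of h, minimality forces g to be constant; if of g, then b vanishes
   at mu although its degree is too small. *)
move: p_root; rewrite {1}ph rmorphM rootM => /orP[hr|gr].
  have := p_min h0 hr; rewrite ph size_mul//.
  have : (0 < size g)%N by rewrite size_poly_gt0.
  have : (0 < size h)%N by rewrite size_poly_gt0.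
  by move: (size h) (size g) => x y; case: x => // x; case: y => // [[|y]] // _ _;
    rewrite addSn addnS /= -addSn -[X in (_ <= X)%N]addn0 leq_add2l.
have /dvdpP[k bk] : g %| b by exact: dvdp_gcdl.
have : root (map_poly ratr b) mu by rewrite bk rmorphM rootM gr orbT.
by move/(p_min b0); rewrite leqNgt bp.
Qed.

Lemma minimal_eq0 (a : {poly R}) : a \is a polyOver Num.int -> a.[mu] = 0 ->
  (size a < size p)%N -> a = 0.
Proof.
move=> /polyOver_int_ratr[b ->]; rewrite size_map_poly => b0 bp.
apply/eqP; rewrite map_poly_eq0; apply: contraLR bp => bn0.
by rewrite -leqNgt; apply: p_min => //; apply/eqP.
Qed.

(** The value q(mu) is the derivative of p at mu, non-zero because the root is simple. *)
Lemma minimal_factor : exists q : {poly R}, [/\ pR = ('X - mu%:P) * q,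
  q \is monic & q.[mu] != 0].
Proof.
have /factor_theorem[q pq] := p_root; exists q; rewrite mulrC; split => //.
  by have := p_monic; rewrite -(map_monic (ratr : {rmorphism rat -> R})) pq
    monicMr// monicXsubC.
by move: p_deriv; rewrite pq derivM derivXsubC mulr1 !hornerE subrr mulr0 add0r.
Qed.

End minimal_factor.

(** * Groups of polynomials and of residues *)

Section bch_general.
Variables (K : fieldType).

Lemma bch6_morph (V W : lmodType K) (brV : V -> V -> V) (brW : W -> W -> W)
    (f : {linear V -> W}) : (forall x y, f (brV x y) = brW (f x) (f y)) ->
  forall x y, f (bch6 brV x y) = bch6 brW (f x) (f y).
Proof.
move=> fbr x y.
have fD u v : f (u + v) = f u + f v := linearD f u v.
have fN u : f (- u) = - f u := linearN f u.
have fZ a u : f (a *: u) = a *: f u by rewrite linearZ.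
by rewrite /bch6 !(fD, fN, fZ, fbr).
Qed.

Variables (V : lmodType K) (br : V -> V -> V).

(* In the application, F relates vectors which agree in the coordinates below
   k, and E those which agree up to k included. *)
Lemma bch6_congr (E F : V -> V -> Prop) :
  (forall x y, E x y -> F x y) ->
  (forall x y z t, E x y -> E z t -> E (x + z) (y + t)) ->
  (forall a x y, E x y -> E (a *: x) (a *: y)) ->
  (forall x y z t, F x y -> F z t -> E (br x z) (br y t)) ->
  forall x y z t, F x y -> F z t ->
  E (bch6 br x z - x - z) (bch6 br y t - y - t).
Proof.
move=> EF ED EZ Fbr x y z t xy zt.
have EN u v : E u v -> E (- u) (- v).
  by move=> uv; rewrite -(scaleN1r u) -(scaleN1r v); exact: EZ.
have cancel (u v t0 t1 t2 t3 t4 t5 t6 t7 t8 : V) :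
    u + v + t0 + t1 - t2 - t3 + t4 + t5 + t6 + t7 + t8 - u - v =
    t0 + t1 - t2 - t3 + t4 + t5 + t6 + t7 + t8.
  rewrite -addrA -opprD; move: (u + v) => {u v} u.
  by rewrite [LHS]addrC !addrA addNr add0r.
rewrite /bch6 (cancel x z) (cancel y t).
repeat first [ refine (ED _ _ _ _ _ _) | refine (EN _ _ _) |
  refine (EZ _ _ _ _) ];
  refine (Fbr _ _ _ _ _ _);
  repeat first [ exact: xy | exact: zt | refine (EF _ _ _);
    refine (Fbr _ _ _ _ _ _) ].
Qed.
End bch_general.

Section bch_bilinear.
Variables (R : realType) (n : nat).
Local Notation V := 'rV[R]_n.
Variable br : V -> V -> V.
Hypotheses (brDl : forall x y z, br (x + y) z = br x z + br y z)
  (brDr : forall x y z, br x (y + z) = br x y + br x z)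
  (brZl : forall a x y, br (a *: x) y = a *: br x y)
  (brZr : forall a x y, br x (a *: y) = a *: br x y).

Let bilinear_sum x y :
  br x y = \sum_i \sum_j (x 0 i * y 0 j) *: br (delta_mx 0 i) (delta_mx 0 j).
Proof.
have br0l z : br 0 z = 0 by rewrite -[X in br X](scale0r z) brZl scale0r.
have br0r z : br z 0 = 0 by rewrite -[X in br _ X](scale0r z) brZr scale0r.
have suml (I : Type) (s : seq I) f z :
  br (\sum_(i <- s) f i) z = \sum_(i <- s) br (f i) z.
  by elim: s => [|i s IH]; rewrite ?big_nil ?br0l// !big_cons brDl IH.
have sumr (I : Type) (s : seq I) f z :
  br z (\sum_(i <- s) f i) = \sum_(i <- s) br z (f i).
  by elim: s => [|i s IH]; rewrite ?big_nil ?br0r// !big_cons brDr IH.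
rewrite {1}[x]row_sum_delta {1}[y]row_sum_delta suml; apply: eq_bigr => i _.
by rewrite sumr; apply: eq_bigr => j _; rewrite brZl brZr scalerA.
Qed.

Variables (T : Type) (F : set_system T).
Context {FF : Filter F}.

Lemma cvg_bilinear (f g : T -> V) (a b : V) : f @ F --> a -> g @ F --> b ->
  br (f t) (g t) @[t --> F] --> br a b.
Proof.
move=> fa gb; apply: cvg_rV => k.
have coordc (h : T -> V) (l : V) i : h @ F --> l -> h t 0 i @[t --> F] -->
  l 0 i.
  by move=> hl; exact: (cvg_comp _ _ hl (@coord_continuous R 1 n 0 i l)).
rewrite (bilinear_sum a b) summxE.
under eq_fun do rewrite bilinear_sum summxE.
apply: cvg_sum_seq => i; rewrite summxE; under eq_fun do rewrite summxE.
apply: cvg_sum_seq => j; rewrite mxE; under eq_fun do rewrite mxE.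
by apply: cvgMr_tmp; apply: cvgM; exact: coordc.
Qed.

Lemma cvg_bch6 (f g : T -> V) (a b : V) : f @ F --> a -> g @ F --> b ->
  bch6 br (f t) (g t) @[t --> F] --> bch6 br a b.
Proof.
move=> fa gb; rewrite /bch6.
have D (u v : T -> V) (k l : V) : u @ F --> k -> v @ F --> l ->
    (fun t => u t + v t) @ F --> k + l by exact: cvgD.
have B (u v : T -> V) (k l : V) : u @ F --> k -> v @ F --> l ->
    (fun t => u t - v t) @ F --> k - l by exact: cvgB.
have Z r (u : T -> V) (k : V) : u @ F --> k ->
    (fun t => r *: u t) @ F --> r *: k by exact: cvgZl_tmp.
cbv beta.
repeat lazymatch goal with
  | |- cvg_to _ (nbhs ?l) => lazymatch l with
    | _ - _ => refine (B _ _ _ _ _ _)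
    | _ + _ => refine (D _ _ _ _ _ _)
    | _ *: _ => refine (Z _ _ _ _)
    | br _ _ => refine (cvg_bilinear _ _)
    | a => exact: fa
    | b => exact: gb
    end
  end.
Qed.

End bch_bilinear.

Section bracket_coord_theory.
Variables (S : comNzRingType).
Implicit Types (l : S) (x y : nat -> S).

Lemma bracket_coordDl l x x' y k :
  bracket_coord l (fun i => x i + x' i) y k = bracket_coord l x y k +
    bracket_coord l x' y k.
Proof. by case: k => [|[|[|[|[|[|[|[|k]]]]]]]] /=; ring. Qed.

Lemma bracket_coordDr l x y y' k :
  bracket_coord l x (fun i => y i + y' i) k = bracket_coord l x y k +
    bracket_coord l x y' k.
Proof. by case: k => [|[|[|[|[|[|[|[|k]]]]]]]] /=; ring. Qed.

Lemma bracket_coordZl l a x y k :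
  bracket_coord l (fun i => a * x i) y k = a * bracket_coord l x y k.
Proof. by case: k => [|[|[|[|[|[|[|[|k]]]]]]]] /=; ring. Qed.

Lemma bracket_coordZr l a x y k :
  bracket_coord l x (fun i => a * y i) k = a * bracket_coord l x y k.
Proof. by case: k => [|[|[|[|[|[|[|[|k]]]]]]]] /=; ring. Qed.

Lemma bracket_coord_eq l x x' y y' k :
  (forall i, (0 < i < k)%N -> x i = x' i /\ y i = y' i) ->
  bracket_coord l x y k = bracket_coord l x' y' k.
Proof.
move=> e; have ex i : (0 < i < k)%N -> x i = x' i by move=> /e[].
have ey i : (0 < i < k)%N -> y i = y' i by move=> /e[].
by case: k e ex ey => [|[|[|[|[|[|[|[|k]]]]]]]] //= _ ex ey; rewrite !ex ?ey.
Qed.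

Lemma bracket_coord_morph (T : comNzRingType) (f : {rmorphism S -> T}) l x y k :
  f (bracket_coord l x y k) = bracket_coord (f l) (f \o x) (f \o y) k.
Proof.
by case: k => [|[|[|[|[|[|[|[|k]]]]]]]] /=;
  rewrite !(rmorph0, rmorphB, rmorphD, rmorphN, rmorphM, rmorph1).
Qed.

End bracket_coord_theory.

Section polynomial_group.
Variables (R : realType) (c : R).

Definition poly7 : Type := {ffun 'I_7 -> {poly R}}.
HB.instance Definition _ := GRing.Lmodule.copy poly7 {ffun 'I_7 -> {poly R}}.

Implicit Types (u v : poly7).
Definition pcoord u (k : nat) : {poly R} := u (inord k.-1).

(* The Lie algebra over R[X] whose structure constant lambda is the
   polynomial c X. *)
Definition poly_bracket u v : poly7 :=
  [ffun k : 'I_7 => bracket_coord (c *: 'X) (pcoord u) (pcoord v) k.+1].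

Definition eval7 (t : R) (u : poly7) : 'rV[R]_7 := \row_i (u i).[t].

Lemma eval7_is_linear t : linear (eval7 t).
Proof. by move=> a u v; apply/rowP => i; rewrite !mxE !ffunE !hornerE. Qed.
HB.instance Definition _ t :=
  GRing.isLinear.Build R poly7 'rV[R]_7 _ (eval7 t) (eval7_is_linear t).

Lemma coord7_eval7 t u k : coord7 (eval7 t u) k = (pcoord u k).[t].
Proof. by rewrite /coord7 mxE. Qed.

Lemma eval7_bracket t u v :
  eval7 t (poly_bracket u v) = lie_bracket (c * t) (eval7 t u) (eval7 t v).
Proof.
apply: coord7_inj => k k7; rewrite coord7_bracket// coord7_eval7 /pcoord ffunE.
have -> : (inord k.-1 : 'I_7).+1 = k by rewrite inordK; case: k k7.
rewrite -[LHS]/(horner_eval t _) bracket_coord_morph /= /horner_eval !hornerE.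
by apply: bracket_coord_eq => i _; rewrite !coord7_eval7.
Qed.

Lemma eval7_bch t u v :
  eval7 t (bch6 poly_bracket u v) = bch6 (lie_bracket (c * t)) (eval7 t u)
    (eval7 t v).
Proof. exact: (bch6_morph (f := eval7 t)) (eval7_bracket t) u v. Qed.

Lemma poly_eq_horner (p q : {poly R}) : (forall t, p.[t] = q.[t]) -> p = q.
Proof.
move=> pq; apply/eqP; rewrite -subr_eq0; apply/negPn/negP => pq0.
pose rs : seq R := [seq i%:R | i <- iota 0 (size (p - q))].
have rs_root : all (root (p - q)) rs.
  by apply/allP => _ /mapP[i _ ->]; rewrite /root !hornerE pq subrr.
have rs_uniq : uniq rs.
  by rewrite map_inj_uniq ?iota_uniq// => i j /eqP; rewrite eqr_nat => /eqP.
by have := max_poly_roots pq0 rs_root rs_uniq; rewrite size_map size_iota ltnn.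
Qed.

(* Evaluations at all t separate polynomials, so that the group axioms over R[X]
   follow from those of the groups G_(c t). *)
Lemma eval7_inj u v : (forall t, eval7 t u = eval7 t v) -> u = v.
Proof.
move=> uv; apply/ffunP => i; apply: poly_eq_horner => t.
by have /rowP/(_ i) := uv t; rewrite !mxE.
Qed.

Lemma poly_bchA u v w : bch6 poly_bracket u (bch6 poly_bracket v w) =
  bch6 poly_bracket (bch6 poly_bracket u v) w.
Proof.
apply: eval7_inj => t; pose L := lie_bracket (c * t).
apply: etrans (eval7_bch t u (bch6 poly_bracket v w)) _.
apply: etrans (congr1 (bch6 L (eval7 t u)) (eval7_bch t v w)) _.
apply: etrans (BCHA (c * t) _ _ _) _; apply: esym.
apply: etrans (eval7_bch t (bch6 poly_bracket u v) w) _.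
exact: (congr1 (fun x => bch6 L x (eval7 t w)) (eval7_bch t u v)).
Qed.

Lemma poly_bch0u u : bch6 poly_bracket 0 u = u.
Proof.
apply: eval7_inj => t; apply: etrans (eval7_bch t 0 u) _.
by rewrite [eval7 t 0]linear0; exact: (BCH0x (c * t)).
Qed.

Lemma poly_bchu0 u : bch6 poly_bracket u 0 = u.
Proof.
apply: eval7_inj => t; apply: etrans (eval7_bch t u 0) _.
by rewrite [eval7 t 0]linear0; exact: (BCHx0 (c * t)).
Qed.

Lemma poly_bchNu u : bch6 poly_bracket (- u) u = 0.
Proof.
apply: eval7_inj => t; apply: etrans (eval7_bch t (- u) u) _.
by rewrite [eval7 t (- u)]linearN [RHS]linear0; exact: (BCHNx (c * t)).
Qed.

Lemma poly_bchuN u : bch6 poly_bracket u (- u) = 0.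
Proof.
apply: eval7_inj => t; apply: etrans (eval7_bch t u (- u)) _.
by rewrite [eval7 t (- u)]linearN [RHS]linear0; exact: (BCHxN (c * t)).
Qed.

(** Beyond u + v only brackets occur, and a coordinate of a bracket involves only coordinates of
    smaller index. *)
Lemma poly_bch_triangular u u' v v' (i : 'I_7) :
  (forall j : 'I_7, (j < i)%N -> u j = u' j /\ v j = v' j) ->
  bch6 poly_bracket u v i - u i - v i = bch6 poly_bracket u' v' i - u' i - v' i.
Proof.
move=> uv.
pose E (k : nat) (x y : poly7) := forall j : 'I_7, (j < k)%N -> x j = y j.
suff : E i.+1 (bch6 poly_bracket u v - u - v)
  (bch6 poly_bracket u' v' - u' - v').
  move=> /(_ i (ltnSn i)) h.
  have sub3 (x y z : poly7) : (x - y - z) i = x i - y i - z i by rewrite !ffunE.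
  exact: (etrans (esym (sub3 _ _ _)) (etrans h (sub3 _ _ _))).
apply: (@bch6_congr _ _ poly_bracket (E i.+1) (E i)).
- by move=> x y xy j ji; apply: xy; exact: ltnW.
- by move=> x y z t xy zt j ji; rewrite !ffunE xy ?zt.
- by move=> a x y xy j ji; rewrite !ffunE xy.
- move=> x y z t xy zt j ji; rewrite !ffunE; apply: bracket_coord_eq => k kj.
  have /andP[k0 {}kj] := kj.
  have ki : (k.-1 < i)%N by rewrite -ltnS prednK//; exact: leq_trans kj _.
  have k7 : (inord k.-1 : 'I_7) = k.-1 :> nat.
    by rewrite inordK//; exact: ltn_trans ki _.
  by rewrite /pcoord xy ?zt ?k7.
- by move=> j /uv[].
- by move=> j /uv[].
Qed.

End polynomial_group.

Section poly_bracket_bilinear.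
Variables (R : realType) (c : R).
Implicit Types (u v x : poly7 R).
Local Notation br := (poly_bracket c).

Lemma poly_bracketDl u x v : br (u + x) v = br u v + br x v.
Proof.
apply/ffunP => i; rewrite !ffunE -bracket_coordDl.
by apply: bracket_coord_eq => j _; rewrite /pcoord ffunE.
Qed.

Lemma poly_bracketDr u v x : br u (v + x) = br u v + br u x.
Proof.
apply/ffunP => i; rewrite !ffunE -bracket_coordDr.
by apply: bracket_coord_eq => j _; rewrite /pcoord ffunE.
Qed.

Lemma poly_bracketZl a u v : br (a *: u) v = a *: br u v.
Proof.
apply/ffunP => i; rewrite !ffunE -[RHS]mul_polyC -bracket_coordZl.
by apply: bracket_coord_eq => j _; rewrite /pcoord ffunE mul_polyC.
Qed.

Lemma poly_bracketZr a u v : br u (a *: v) = a *: br u v.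
Proof.
apply/ffunP => i; rewrite !ffunE -[RHS]mul_polyC -bracket_coordZr.
by apply: bracket_coord_eq => j _; rewrite /pcoord ffunE mul_polyC.
Qed.

End poly_bracket_bilinear.

(** * The group of points over R[X]/(q) *)

Section residue.
Variables (R : realType) (c : R) (m : nat) (q : {poly R}).
Hypothesis q_size : size q = m.+1.
Local Notation V := 'rV[R]_(7 * m).
Local Notation br := (poly_bracket c).

(** By linearity over R[X], a multiple of q in an argument contributes a multiple of q. *)
Lemma bracket_coord_modl (l : {poly R}) x y k :
  bracket_coord l x y k %% q = bracket_coord l (fun i => x i %% q) y k %% q.
Proof.
have -> : bracket_coord l x y k =
    bracket_coord l (fun i => q * (x i %/ q) + x i %% q) y k.
  by apply: bracket_coord_eq => i _; rewrite mulrC -divp_eq.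
by rewrite bracket_coordDl bracket_coordZl modpD modp_mulr add0r.
Qed.

Lemma bracket_coord_modr (l : {poly R}) x y k :
  bracket_coord l x y k %% q = bracket_coord l x (fun i => y i %% q) k %% q.
Proof.
have -> : bracket_coord l x y k =
    bracket_coord l x (fun i => q * (y i %/ q) + y i %% q) k.
  by apply: bracket_coord_eq => i _; rewrite mulrC -divp_eq.
by rewrite bracket_coordDr bracket_coordZr modpD modp_mulr add0r.
Qed.

(* Residues modulo q are represented by the coefficients of remainders. *)
Definition lift7 (h : V) : poly7 R := [ffun i => rVpoly (row i (vec_mx h))].
Definition red7 (u : poly7 R) : V := mxvec (\matrix_i poly_rV (u i %% q)).

Lemma red7_is_linear : linear red7.
Proof.
move=> a u v; rewrite /red7 -linearP; congr mxvec; apply/matrixP => i j.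
by rewrite !mxE !ffunE modpD modpZl coefD coefZ.
Qed.
HB.instance Definition _ :=
  GRing.isLinear.Build R (poly7 R) V _ red7 red7_is_linear.

Lemma lift7_is_linear : linear lift7.
Proof.
by move=> a u v; apply/ffunP => i; rewrite !ffunE !linearP.
Qed.
HB.instance Definition _ :=
  GRing.isLinear.Build R V (poly7 R) _ lift7 lift7_is_linear.

Let q0 : q != 0. Proof. by rewrite -size_poly_gt0 q_size. Qed.

Lemma lift7_mod h i : lift7 h i %% q = lift7 h i.
Proof. by rewrite ffunE modp_small// q_size ltnS size_poly. Qed.

Lemma lift7K : cancel lift7 red7.
Proof.
move=> h; rewrite /red7 -[RHS]vec_mxK; congr mxvec; apply/row_matrixP => i.
by rewrite rowK lift7_mod ffunE rVpolyK.
Qed.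

Lemma red7K u i : lift7 (red7 u) i = u i %% q.
Proof.
rewrite ffunE /red7 mxvecK rowK poly_rV_K//.
by rewrite -ltnS -q_size ltn_modp.
Qed.

Definition residue_bracket (h k : V) : V := red7 (br (lift7 h) (lift7 k)).

Lemma red7_bracket u v : red7 (br u v) = residue_bracket (red7 u) (red7 v).
Proof.
rewrite /residue_bracket /red7; congr mxvec; apply/row_matrixP => i.
rewrite !rowK; congr poly_rV;
  rewrite !ffunE bracket_coord_modl bracket_coord_modr.
by congr (_ %% q); apply: bracket_coord_eq => j _; rewrite /pcoord !red7K.
Qed.

Local Notation BCH := (bch6 residue_bracket).

Lemma red7_bch u v : red7 (bch6 br u v) = BCH (red7 u) (red7 v).
Proof. exact: (bch6_morph (f := red7)) red7_bracket u v. Qed.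

(** [red7] is a surjective morphism, with section [lift7], so this and the other group laws descend
    from R[X]. *)
Lemma residue_bchA : associative BCH.
Proof.
move=> x y z; rewrite -[x]lift7K -[y]lift7K -[z]lift7K.
move: (lift7 x) (lift7 y) (lift7 z) => u v w.
apply: etrans (congr1 (BCH (red7 u)) (esym (red7_bch v w))) _.
apply: etrans (esym (red7_bch u (bch6 br v w))) _.
apply: etrans (congr1 red7 (poly_bchA c u v w)) _.
apply: etrans (red7_bch (bch6 br u v) w) _.
exact: (congr1 (fun t => BCH t (red7 w)) (red7_bch u v)).
Qed.

Let red70 : red7 0 = 0. Proof. exact: linear0. Qed.
Let red7N u : red7 (- u) = - red7 u. Proof. exact: linearN. Qed.

Lemma residue_bch0x : left_id 0 BCH.
Proof.
move=> x; rewrite -[x]lift7K -red70; apply: etrans (esym (red7_bch _ _)) _.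
by rewrite poly_bch0u.
Qed.

Lemma residue_bchx0 : right_id 0 BCH.
Proof.
move=> x; rewrite -[x]lift7K -red70; apply: etrans (esym (red7_bch _ _)) _.
by rewrite poly_bchu0.
Qed.

Lemma residue_bchNx : left_inverse 0 -%R BCH.
Proof.
move=> x; rewrite -[x]lift7K -red7N; apply: etrans (esym (red7_bch _ _)) _.
by rewrite poly_bchNu red70.
Qed.

Lemma residue_bchxN : right_inverse 0 -%R BCH.
Proof.
move=> x; rewrite -[x]lift7K -red7N; apply: etrans (esym (red7_bch _ _)) _.
by rewrite poly_bchuN red70.
Qed.

Lemma residue_bch_continuous : continuous (fun p : V * V => BCH p.1 p.2).
Proof.
move=> p; apply: cvg_bch6; rewrite /residue_bracket.
- by move=> x y z; rewrite linearD poly_bracketDl linearD.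
- by move=> x y z; rewrite linearD poly_bracketDr linearD.
- by move=> a x y; rewrite linearZ poly_bracketZl linearZ.
- by move=> a x y; rewrite linearZ poly_bracketZr linearZ.
- exact: cvg_fst.
- exact: cvg_snd.
Qed.

End residue.

(** The parameters c and [q_size] are kept in the type so that the group structure they determine
    can be attached to it. *)
Definition residue_group (R : realType) (c : R) (m : nat) (q : {poly R})
  (q_size : size q = m.+1) : Type := 'rV[R]_(7 * m).

Section residue_group.
Variables (R : realType) (c : R) (m : nat) (q : {poly R})
  (q_size : size q = m.+1).
Local Notation H := (residue_group c q_size).

HB.instance Definition _ := Topological.copy H 'rV[R]_(7 * m).
HB.instance Definition _ := isGroup.Build H (residue_bchA c q_size)
  (residue_bch0x c q_size) (residue_bchx0 c q_size) (residue_bchNx c q_size)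
  (residue_bchxN c q_size).

Let H_mulg_continuous : continuous (fun p : H * H => (p.1 * p.2)%g).
Proof. exact: residue_bch_continuous. Qed.

Let H_invg_continuous : continuous (fun x : H => x^-1%g).
Proof. exact: (@opp_continuous 'rV[R]_(7 * m)). Qed.

HB.instance Definition _ :=
  isTopologicalGroup.Build H H_mulg_continuous H_invg_continuous.

End residue_group.

Lemma continuous_linear_rV (R : realType) (a b : nat)
    (f : 'rV[R]_a -> 'rV[R]_b) : linear f -> continuous f.
Proof.
move=> fl.
have f0 : f 0 = 0 by have := fl (-1) 0 0; rewrite scaler0 addr0 scaleN1r addNr.
have fsum (s : seq 'I_a) (x : 'rV[R]_a) :
    f (\sum_(i <- s) x 0 i *: delta_mx 0 i) = \sum_(i <- s) x 0 i *:
      f (delta_mx 0 i).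
  by elim: s => [|i s IH]; rewrite ?big_nil// !big_cons fl IH.
have fE j x : f x 0 j = \sum_i x 0 i * f (delta_mx 0 i) 0 j.
  rewrite {1}[x]row_sum_delta fsum summxE.
  by apply: eq_bigr => i _; rewrite mxE.
apply: continuous_rV => j v.
rewrite /continuous_at fE; under eq_fun do rewrite fE.
apply: (cvg_sum_seq (nbhs_filter v)) => i.
by apply: cvgMr_tmp; exact: coord_continuous.
Qed.

(** * Integrality of the Baker-Campbell-Hausdorff product *)

Section integrality.
(* 1440 is a common denominator of the coefficients of [bch6]; it is named e
   because the unary numeral is costly to manipulate. *)
Variables (R : realType) (D e : nat).
Hypotheses (D_gt0 : (0 < D)%N) (e_def : e = 1440%N).
Local Notation c := (D%:R^-1 : R).
Local Notation N := ((e * D)%:R : R).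
Local Notation br := (poly_bracket c).

Definition integral7 (a : R) (u : poly7 R) : Prop :=
  forall i, a^-1 *: u i \is a polyOver Num.int.

Let e0 : e%:R != 0 :> R. Proof. by rewrite pnatr_eq0 e_def. Qed.
Let D0 : D%:R != 0 :> R. Proof. by rewrite pnatr_eq0 -lt0n. Qed.

Lemma bracket_coord_int (x y : nat -> {poly R}) k :
  (forall i, x i \is a polyOver Num.int) ->
    (forall i, y i \is a polyOver Num.int) ->
  D%:R%:P * bracket_coord (c *: 'X) x y k \is a polyOver Num.int.
Proof.
move=> xi yi.
have Di : (D%:R%:P : {poly R}) \is a polyOver Num.int.
  by apply: int_polyC; exact: rpred_nat.
have DX : D%:R%:P * (c *: 'X) = 'X :> {poly R}.
  by rewrite mul_polyC scalerA divff// scale1r.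
case: k => [|[|[|[|[|[|[|[|k]]]]]]]] /=; rewrite ?mulr0; try exact: polyOver0;
  last first.
  have dE (d l u v w : {poly R}) :
      d * (u + l * v + (1 - l) * w) = d * u + d * l * v + (d - d * l) * w
        by ring.
  rewrite dE DX.
  by do ?[exact: xi|exact: yi|exact: Di|exact: int_polyX|refine (int_polyM _ _)
    |refine (int_polyB _ _)|refine (int_polyD _ _)].
all: by do ?[exact: xi|exact: yi|exact: Di|exact: int_polyX
  |refine (int_polyM _ _)|refine (int_polyB _ _)|refine (int_polyD _ _)].
Qed.

(** Bilinearity gives a factor N^2, of which D clears the denominator of the structure constant X /
    D; what is left is N^2 / D = e N. *)
Lemma integral7_bracket u v : integral7 N u -> integral7 N v ->
  integral7 (e%:R * N) (br u v).
Proof.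
move=> ui vi k; rewrite ffunE.
have N0 : N != 0 by rewrite natrM mulf_neq0.
have xE (x : poly7 R) i : pcoord x i = N%:P * (N^-1 *: pcoord x i).
  by rewrite mul_polyC scalerA divff// scale1r.
have -> : bracket_coord (c *: 'X) (pcoord u) (pcoord v) k.+1 =
    bracket_coord (c *: 'X) (fun i => N%:P * (N^-1 *: pcoord u i))
      (fun i => N%:P * (N^-1 *: pcoord v i)) k.+1.
  by apply: bracket_coord_eq => i _; rewrite -!xE.
rewrite bracket_coordZl bracket_coordZr -mul_polyC !mulrA -!polyCM.
have -> : (e%:R * N)^-1 * N * N = D%:R.
  by rewrite natrM; field; rewrite D0 e0.
by apply: bracket_coord_int => i; rewrite /pcoord; [exact: ui|exact: vi].
Qed.

(** The factor e = 1440 gained by each bracket absorbs the denominators of [bch6], which all divide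
    1440. *)
Lemma integral7_bch u v : integral7 N u -> integral7 N v ->
  integral7 N (bch6 br u v).
Proof.
move=> ui vi; have br1 x y : integral7 N x -> integral7 N y ->
    integral7 (e%:R * N) (br x y) by exact: integral7_bracket.
have intD a x y : integral7 a x -> integral7 a y -> integral7 a (x + y).
  by move=> xi yi i; rewrite ffunE scalerDr; exact: int_polyD.
have intN a x : integral7 a x -> integral7 a (- x).
  by move=> xi i; rewrite ffunE scalerN; exact: int_polyN.
have int1 x : integral7 (e%:R * N) x -> integral7 N x.
  move=> xi i; rewrite (_ : N^-1 = e%:R * (e%:R * N)^-1); last first.
    by rewrite invfM mulrA divff ?mul1r.
  rewrite -scalerA -mul_polyC; apply: int_polyM => //.
  by apply: int_polyC; exact: rpred_nat.
have intZ (k l : nat) x : (k * l == 1440)%N -> integral7 (e%:R * N) x ->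
    integral7 N (k%:R^-1 *: x).
  move=> /eqP; rewrite -e_def => kl xi i; rewrite ffunE scalerA.
  have k0 : k%:R != 0 :> R by rewrite pnatr_eq0; apply/eqP => k0; move: e0;
    rewrite -kl k0 mul0n eqxx.
  rewrite (_ : N^-1 / k%:R = l%:R * (e%:R * N)^-1); last first.
    have l0 : l%:R != 0 :> R.
      by rewrite pnatr_eq0; apply/eqP => l0; move: e0;
        rewrite -kl l0 muln0 eqxx.
    have N0 : N != 0 by rewrite natrM mulf_neq0.
    have -> : e%:R = k%:R * l%:R :> R by rewrite -natrM kl.
    by move: N N0 => y y0; field; rewrite y0 k0 l0.
  rewrite -scalerA -mul_polyC; apply: int_polyM => //.
  by apply: int_polyC; exact: rpred_nat.
rewrite /bch6.
repeat lazymatch goal with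
| |- integral7 N (_ + _) => refine (intD _ _ _ _ _)
| |- integral7 N (- _) => refine (intN _ _ _)
| |- integral7 N (?k%:R^-1 *: _) =>
    let l := eval compute in (1440 %/ k)%N in refine (intZ k l _ isT _)
| |- integral7 (_ * _) (_ + _) => refine (intD _ _ _ _ _)
| |- integral7 (_ * _) (- _) => refine (intN _ _ _)
| |- integral7 (_ * _) (br _ _) => refine (br1 _ _ _ _)
| |- integral7 N (br _ _) => refine (int1 _ _)
| |- integral7 N u => exact: ui
| |- integral7 N v => exact: vi
end.
Qed.

End integrality.

(** * The arithmetic lattice and the model set *)

Section arithmetic_lattice.
Variables (R : realType) (D e : nat).
Hypotheses (D_gt0 : (0 < D)%N) (e_def : e = 1440%N).
Local Notation c := (D%:R^-1 : R).
Local Notation N := ((e * D)%:R : R).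
Variables (mu : R) (m : nat) (q : {poly R}).
Hypotheses (q_size : size q = m.+1) (q_mu : q.[mu] != 0).
Local Notation p := (('X - mu%:P) * q).
Hypotheses (p_monic : p \is monic) (p_int : p \is a polyOver Num.int)
  (p_min : forall a : {poly R}, a \is a polyOver Num.int -> a.[mu] = 0 ->
     (size a < size p)%N -> a = 0).
Local Notation br := (poly_bracket c).
Local Notation G := (Glambda (c * mu)).
Local Notation H := (residue_group c q_size).
Local Notation E := 'rV[R]_(7 * m.+1).

Let N0 : N != 0.
Proof. by rewrite natrM mulf_neq0// pnatr_eq0 ?e_def// -lt0n. Qed.

Let p_size : size p = m.+2.
Proof. by rewrite mulrC size_Mmonic ?monicXsubC -?size_poly_gt0 ?q_size//
  size_XsubC addn2. Qed.

(** The coordinates x are coefficients of representatives modulo p, scaled so that integral x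
    correspond to N Z[X]/(p). *)
Definition lat (x : E) : poly7 R := N *: lift7 (m := m.+1) x.

Definition theta (x : E) : (G * H)%type := (eval7 mu (lat x), red7 m q (lat x)).

(* The Chinese remainder theorem: these polynomials have degree at most m, value
   g at mu, and residue h modulo q. *)
Definition crt7 (g : 'rV[R]_7) (h : 'rV[R]_(7 * m)) : poly7 R :=
  [ffun i => lift7 h i + ((g 0 i - (lift7 h i).[mu]) / q.[mu]) *: q].

Definition theta_inv (z : (G * H)%type) : E := N^-1 *:
  red7 m.+1 p (crt7 z.1 z.2).

Let eval7_crt7 g h : eval7 mu (crt7 g h) = g.
Proof. by apply/rowP => i; rewrite !mxE ffunE !hornerE divfK// addrC subrK. Qed.

Let red7_crt7 g h : red7 m q (crt7 g h) = h.
Proof.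
rewrite -[RHS](lift7K q_size) /red7; congr mxvec; apply/row_matrixP => i.
by rewrite !rowK ffunE modpD modpZl modpp scaler0 addr0.
Qed.

(** The congruence is checked modulo X - mu and modulo q, which are coprime because q(mu) is
    non-zero. *)
Let crt7_mod u i : crt7 (eval7 mu u) (red7 m q u) i %% p = u i %% p.
Proof.
apply/eqP; rewrite -subr_eq0 -modpN -modpD -/(dvdp _ _); apply/eqP/modp_eq0P.
rewrite Gauss_dvdp; last by rewrite coprimep_sym coprimep_XsubC.
apply/andP; split.
  rewrite dvdp_XsubCl /root hornerD hornerN ffunE !hornerE divfK//.
  by rewrite mxE; apply/eqP; ring.
rewrite ffunE red7K// /dvdp modpD modpD modpN modp_id modpZl modpp scaler0
  addr0.
by rewrite subrr.
Qed.

Let red7_crt7_mod u : red7 m.+1 p (crt7 (eval7 mu u) (red7 m q u)) = red7 m.+1 p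
  u.
Proof.
rewrite /red7; congr mxvec; apply/row_matrixP => i.
by rewrite !rowK crt7_mod.
Qed.

Let latK x : N^-1 *: red7 m.+1 p (lat x) = x.
Proof. by rewrite /lat linearZ /= lift7K// scalerA mulVf// scale1r. Qed.

Lemma thetaK : cancel theta theta_inv.
Proof. by move=> x; rewrite /theta_inv /= red7_crt7_mod latK. Qed.

Lemma theta_invK : cancel theta_inv theta.
Proof.
move=> [g h]; rewrite /theta /theta_inv /=; set u := crt7 g h.
have -> : lat (N^-1 *: red7 m.+1 p u) = u.
  rewrite /lat linearZ /= scalerA divff// scale1r; apply/ffunP => i.
  rewrite red7K// modp_small// p_size ltnS /u ffunE.
  apply: leq_trans (size_polyD _ _) _; rewrite geq_max; apply/andP; split.
    by rewrite ffunE (leq_trans (size_poly _ _)).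
  by apply: leq_trans (size_scale_leq _ _) _; rewrite q_size.
by rewrite /u eval7_crt7 red7_crt7.
Qed.

Lemma thetaM x y : (theta x * theta y)%g =
  (eval7 mu (bch6 br (lat x) (lat y)), red7 m q (bch6 br (lat x) (lat y))) :> G
    * H.
Proof. by congr pair; [exact/esym/eval7_bch|exact/esym/red7_bch]. Qed.

Lemma theta0 : theta 0 = 1%g.
Proof.
by rewrite /theta /lat; congr pair; rewrite !linear0.
Qed.

Lemma thetaV x : ((theta x)^-1)%g = theta (- x).
Proof. by rewrite /theta /lat; congr pair; rewrite !linearN. Qed.

Lemma theta_inv_thetaM x y :
  theta_inv (theta x * theta y)%g = N^-1 *:
    red7 m.+1 p (bch6 br (lat x) (lat y)).
Proof. by rewrite thetaM /theta_inv /= red7_crt7_mod. Qed.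

Let lat_int x : integral_rV x -> integral7 N (lat x).
Proof.
move=> xi i; rewrite !ffunE scalerA mulVf// scale1r.
by apply/polyOverP => j; rewrite coef_rVpoly; case: insubP => [k _ _|_];
  rewrite ?mxE ?xi// int_num0.
Qed.

(** The product stays in N Z[X], and so does its remainder modulo p, which is monic with integer
    coefficients. *)
Lemma theta_inv_thetaM_int x y : integral_rV x -> integral_rV y ->
  integral_rV (theta_inv (theta x * theta y)%g).
Proof.
move=> /lat_int xi /lat_int yi; rewrite theta_inv_thetaM.
have := integral7_bch D_gt0 e_def xi yi; move: (bch6 _ _ _) => u ui k.
case/mxvec_indexP: k => i j; rewrite -linearZ /= /red7 mxvecE !mxE.
apply/polyOverP: j; rewrite ffunE; exact: modp_int.
Qed.

Lemma theta_inv_int x : integral_rV x -> integral_rV (theta_inv (theta x)^-1%g).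
Proof. by move=> xi i; rewrite thetaV thetaK mxE rpredN. Qed.

(** The index, from 0 to 6, of the basis vector to which a flattened coordinate belongs; the m + 1
    coefficients of one polynomial share it. *)
Definition row_weight (k : 'I_(7 * m.+1)) : nat :=
  (enum_val (cast_ord (esym (mxvec_cast 7 m.+1)) k)).1.

Let row_weightE i j : row_weight (mxvec_index i j) = i.
Proof. by rewrite /row_weight cast_ordK enum_rankK. Qed.

Let lat_agree (x x' : E) (i : 'I_7) :
  (forall k, (row_weight k < i)%N -> x 0 k = x' 0 k) ->
  forall j : 'I_7, (j < i)%N -> lat x j = lat x' j.
Proof.
move=> xx' j ji; rewrite !ffunE; congr (_ *: rVpoly _); apply/rowP => k.
by rewrite !mxE xx'// row_weightE.
Qed.

Lemma theta_triangular (x x' y y' : E) k :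
  (forall j, (row_weight j < row_weight k)%N -> x 0 j = x' 0 j /\
    y 0 j = y' 0 j) ->
  theta_inv (theta x * theta y)%g 0 k - x 0 k - y 0 k =
  theta_inv (theta x' * theta y')%g 0 k - x' 0 k - y' 0 k.
Proof.
case/mxvec_indexP: k => i j; rewrite row_weightE => xy.
have entry u : (N^-1 *: red7 m.+1 p u) 0 (mxvec_index i j) = N^-1 *
  (u i %% p)`_j.
  by rewrite mxE /red7 mxvecE !mxE.
have E3 z z' : theta_inv (theta z * theta z')%g 0 (mxvec_index i j)
    - z 0 (mxvec_index i j) - z' 0 (mxvec_index i j) =
    N^-1 * ((bch6 br (lat z) (lat z') i - lat z i - lat z' i) %% p)`_j.
  rewrite theta_inv_thetaM -{2}[z]latK -{2}[z']latK !entry.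
  by rewrite !modpD !modpN !coefD !coefN !mulrDr !mulrN.
rewrite !E3; congr (_ * (_ %% p)`_j); apply: poly_bch_triangular => l li.
by split; apply: lat_agree li => k ki; have [] := xy k ki.
Qed.

End arithmetic_lattice.

(** * Approximation by integer polynomials modulo q *)

Section density.
Variables (R : realType) (m : nat) (q : {poly R}).
Hypotheses (q_size : size q = m.+1) (q_monic : q \is monic).

Let q0 : q != 0. Proof. exact: monic_neq0. Qed.

Definition residue_norm (n : nat) : R :=
  \sum_(i < n) \sum_(l < m) `|('X^i %% q)`_l|.

Let residue_norm_ge0 n : 0 <= residue_norm n.
Proof. by apply: sumr_ge0 => i _; apply: sumr_ge0. Qed.

Lemma residue_bound (n : nat) (r : {poly R}) (d : R) (k : nat) :
  0 <= d -> (size r <= n)%N -> (forall i, `|r`_i| <= d) ->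
  `|(r %% q)`_k| <= d * residue_norm n.
Proof.
move=> d0 rn rd; have [km|mk] := ltnP k m; last first.
  rewrite nth_default ?normr0 ?mulr_ge0//.
  by apply: leq_trans mk; rewrite -ltnS -q_size ltn_modp.
have -> : r = \sum_(i < n) r`_i *: 'X^i.
  rewrite -{1}[r]coefK poly_def (big_ord_widen n (fun i => r`_i *: 'X^i))//.
  rewrite big_mkcond; apply: eq_bigr => i _; case: ltnP => // ri.
  by rewrite nth_default// scale0r.
have modD (I : Type) (s : seq I) (f : I -> {poly R}) :
    (\sum_(i <- s) f i) %% q = \sum_(i <- s) (f i %% q).
  by elim: s => [|i s IH]; rewrite ?big_nil ?mod0p// !big_cons modpD IH.
rewrite modD coef_sum mulr_sumr; apply: le_trans (ler_norm_sum _ _ _) _.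
apply: ler_sum => i _; rewrite modpZl coefZ normrM; apply: ler_pM => //.
by rewrite (bigD1 (Ordinal km))//= lerDl sumr_ge0.
Qed.

(** By the pigeonhole principle, two multiples s q and t q have close fractional parts. The
    difference of their integer parts is then an integer polynomial, congruent modulo q to one with
    small coefficients. *)
Lemma small_residue (d : R) : 0 < d -> exists a : {poly R},
  [/\ a \is a polyOver Num.int, a != 0, (size a <= m.+1)%N &
      forall k, `|(a %% q)`_k| < d].
Proof.
move=> d0; set B := residue_norm m.+1.
have B0 : 0 <= B by exact: residue_norm_ge0.
(* Coefficients bounded by 1 / (M + 1) have remainders bounded by B / (M + 1), which this M makes
   smaller than d. *)
have [M Md] : exists M : nat, M.+1%:R^-1 * (B + 1) < d.
  exists (Num.truncn ((B + 1) / d)).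
  rewrite mulrC ltr_pdivrMr// mulrC -ltr_pdivrMr//; exact: truncnS_gt.
(* The coefficients of n q modulo 1 are sorted into M + 1 intervals of equal length. *)
pose cell (n : nat) : {ffun 'I_m.+1 -> 'I_M.+1} :=
  [ffun i : 'I_m.+1 => inord (Num.truncn (M.+1%:R * frac_part (n%:R * q`_i)))].
have cellE n (i : 'I_m.+1) :
  (cell n i)%:R <= M.+1%:R * frac_part (n%:R * q`_i) < (cell n i).+1%:R.
  have /andP[f0 f1] := frac_part_itv (n%:R * q`_i).
  rewrite ffunE inordK; first by apply: truncn_itv; rewrite mulr_ge0.
  by rewrite truncn_lt_nat ?mulr_ge0// gtr_pMr.
pose K := #|{ffun 'I_m.+1 -> 'I_M.+1}|.
have [s [t [st stc]]] : exists s t : nat, s != t /\ cell s = cell t.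
  apply: contrapT => H; have cinj : injective (fun s : 'I_K.+1 => cell s).
    move=> s t st; apply/val_inj/eqP; apply: contrapT => /negP nst.
    by apply: H; exists s, t.
  by have := leq_card _ cinj; rewrite card_ord ltnn.
pose a := \poly_(i < m.+1)
  ((Num.floor (s%:R * q`_i))%:~R - (Num.floor (t%:R * q`_i))%:~R : R).
pose r := \poly_(i < m.+1) (frac_part (s%:R * q`_i) - frac_part (t%:R * q`_i)).
have qm : q`_m = 1 by have := monicP q_monic; rewrite lead_coefE q_size.
have aE : a = (s%:R - t%:R) *: q - r.
  apply/polyP => i; rewrite coefB coefZ !coef_poly; case: ltnP => im.
    by rewrite /frac_part; ring.
  by rewrite nth_default ?q_size// mulr0 subr0.
exists a; split.
- apply/polyOverP => i; rewrite coef_poly; case: ifP => _; last exact: rpred0.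
  by apply: rpredB; exact: intr_int.
(* As q is monic, the coefficient of degree m of a is s - t, which is non-zero. *)
- apply/eqP => /polyP/(_ m); rewrite coef_poly ltnSn qm coef0 !mulr1.
  rewrite !floorK ?rpred_nat// => /eqP.
  by rewrite subr_eq0 eqr_nat (negbTE st).
- exact: size_poly.
move=> k; rewrite aE modpD modpN modpZl modpp scaler0 add0r coefN normrN.
apply: le_lt_trans (_ : M.+1%:R^-1 * B < d).
  apply: residue_bound; [by rewrite invr_ge0|exact: size_poly|move=> i].
  rewrite coef_poly; case: ltnP => im; last by rewrite normr0 invr_ge0.
  have := cellE s (Ordinal im); have := cellE t (Ordinal im); rewrite stc /=.
  set x := frac_part _; set y := frac_part _; set k0 := (cell t _ : nat).
  have M0 : 0 < M.+1%:R :> R by rewrite ltr0n.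
  rewrite -natr1 => /andP[? ?] /andP[? ?].
  rewrite -[leRHS]mulr1 ler_pdivlMl// -[X in X * _]gtr0_norm// -normrM
    ler_norml.
  by rewrite mulrBr; apply/andP; split; lra.
by apply: le_lt_trans Md; rewrite ler_pM2l ?invr_gt0// lerDl.
Qed.

Hypothesis q_coprime : forall a : {poly R}, a \is a polyOver Num.int ->
  a != 0 ->
  (size a <= m.+1)%N -> coprimep a q.

(* An integer polynomial [a0] which is small modulo q is a unit modulo q, so
   that its multiples by integer polynomials form a fine net. *)
Lemma dense_residue (b : {poly R}) (d : R) : 0 < d ->
  exists2 a : {poly R}, a \is a polyOver Num.int &
    forall k, `|((a - b) %% q)`_k| < d.
Proof.
move=> d0; set B := residue_norm (m + m).
have B0 : 0 <= B by exact: residue_norm_ge0.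
have mB0 : 0 <= (m + m)%:R * B by rewrite mulr_ge0.
have mB1 : 0 < (m + m)%:R * B + 1 by rewrite ltr_wpDl.
(* In the final error, a coefficient of the product sums at most m + m terms within this tolerance,
   and reduction modulo q costs a factor B. *)
have [|a0 [a0i a00 a0s a0d]] := @small_residue (d / ((m + m)%:R * B + 1)).
  by rewrite divr_gt0.
have /Bezout_eq1_coprimepP[[u v] uv] := q_coprime a0i a00 a0s.
have {}uv : u * a0 + v * q = 1 :> {poly R} by exact: uv.
(* As u inverts a0 modulo q, the real polynomial w satisfies a0 w = b modulo q; z rounds its
   coefficients down to integers. *)
pose w : {poly R} := (b * u) %% q.
have ws : (size w <= m)%N by rewrite -ltnS -q_size ltn_modp.
pose z := \poly_(i < m) ((Num.floor w`_i)%:~R : R).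
exists (a0 * z).
  apply: int_polyM => //; apply/polyOverP => i; rewrite coef_poly.
  by case: ifP => _; [exact: intr_int|exact: rpred0].
move=> k; pose a' : {poly R} := a0 %% q.
have a's : (size a' <= m)%N by rewrite -ltnS -q_size ltn_modp.
have zw1 l : `|(z - w)`_l| <= 1.
  rewrite coefB coef_poly; case: ltnP => lm; last first.
    by rewrite nth_default ?subrr ?normr0//; exact: leq_trans lm.
  have /andP[f0 f1] := frac_part_itv w`_l.
  by rewrite distrC ger0_norm// ltW.
have prod_size : (size (a' * (z - w))%R <= m + m)%N.
  apply: leq_trans (size_polyMleq _ _) _; apply: leq_trans (leq_pred _) _.
  apply: leq_add => //; apply: leq_trans (size_polyD _ _) _.
  by rewrite geq_max size_poly size_polyN.
have -> : (a0 * z - b) %% q = (a' * (z - w)) %% q.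
  have bE : b = b * u * a0 + b * v * q by rewrite -!mulrA -mulrDr uv mulr1.
  have a0E : a0 = a0 %/ q * q + a' by exact: divp_eq.
  have buE : b * u = (b * u) %/ q * q + w by exact: divp_eq.
  have -> : a0 * z - b = a' * (z - w)
      + (- (b * v) + a0 %/ q * (z - b * u) - a' * ((b * u) %/ q)) * q.
    rewrite {1}bE; move: (a0 %/ q) ((b * u) %/ q) a0E buE => Q1 Q2 a0E buE.
    transitivity (a0 * (z - b * u) - b * v * q); first by ring.
    transitivity (a' * (z - b * u) + Q1 * (z - b * u) * q - b * v * q).
      by rewrite {1}a0E; ring.
    by rewrite {1}buE; ring.
  by rewrite modpD modp_mull addr0.
pose d' := d / ((m + m)%:R * B + 1).
have d'0 : 0 < d' by rewrite divr_gt0.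
apply: le_lt_trans (_ : d' * (m + m)%:R * B < d).
  apply: residue_bound => // [|i]; first by rewrite mulr_ge0// ltW.
  have [im|mi] := ltnP i (m + m); last first.
    rewrite nth_default; last exact: leq_trans prod_size mi.
    by rewrite normr0 mulr_ge0// ltW.
  rewrite coefM; apply: le_trans (ler_norm_sum _ _ _) _.
  apply: (@le_trans _ _ (\sum_(j < i.+1) d')).
    apply: ler_sum => j _; rewrite normrM -[leRHS]mulr1; apply: ler_pM => //.
    exact/ltW/a0d.
  by rewrite sumr_const card_ord -[d' *+ _]mulr_natr ler_wpM2l ?ler_nat// ltW.
rewrite -mulrA /d' mulrAC ltr_pdivrMr// ltr_pM2l//; lra.
Qed.

End density.

Lemma lcsc_Glambda (R : realType) (lambda : R) : lcsc (Glambda lambda).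
Proof.
split; first exact: (@norm_hausdorff R 'rV[R]_7).
- exact: (@rV_locally_compact R 7).
- exact: (@rV_second_countable R 7).
Qed.

Lemma lcsc_residue_group (R : realType) (c : R) (m : nat) (q : {poly R})
  (q_size : size q = m.+1) : lcsc (residue_group c q_size).
Proof.
split; first exact: (@norm_hausdorff R 'rV[R]_(7 * m)).
- exact: (@rV_locally_compact R (7 * m)).
- exact: (@rV_second_countable R (7 * m)).
Qed.

(** * The cut-and-project scheme *)

Section cut_and_project.
Variables (R : realType) (D e : nat).
Hypotheses (D_gt0 : (0 < D)%N) (e_def : e = 1440%N).
Local Notation c := (D%:R^-1 : R).
Local Notation N := ((e * D)%:R : R).
Variables (mu : R) (m : nat) (q : {poly R}).
Hypotheses (q_size : size q = m.+1) (q_mu : q.[mu] != 0)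
  (q_monic : q \is monic).
Local Notation p := (('X - mu%:P) * q).
Hypotheses (p_int : p \is a polyOver Num.int)
  (p_min : forall a : {poly R}, a \is a polyOver Num.int -> a.[mu] = 0 ->
     (size a < size p)%N -> a = 0)
  (p_coprime : forall a : {poly R}, a \is a polyOver Num.int -> a != 0 ->
     (size a < size p)%N -> coprimep a p).
Local Notation G := (Glambda (c * mu)).
Local Notation H := (residue_group c q_size).
Local Notation E := 'rV[R]_(7 * m.+1).

Let p_monic : p \is monic. Proof. by rewrite monicMr ?monicXsubC. Qed.

Let p_size : size p = m.+2.
Proof. by rewrite size_monicM ?monicXsubC// ?monic_neq0// size_XsubC q_size.
  Qed.

Let N0 : N != 0.
Proof. by rewrite natrM mulf_neq0// pnatr_eq0 ?e_def// -lt0n. Qed.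

Definition scheme_lattice : set (G * H)%type :=
  theta D e mu q_size @` @integral_rV R (7 * m.+1).

Let lat_is_linear : linear (@lat R D e m).
Proof. by move=> a x y; rewrite /lat linearP scalerDr !scalerA mulrC. Qed.

Let theta_continuous : continuous (theta D e mu q_size).
Proof.
have c1 : continuous (fun x : E => eval7 mu (@lat R D e m x)).
  by apply: continuous_linear_rV => a x y; rewrite lat_is_linear linearP.
have c2 : continuous (fun x : E => red7 m q (@lat R D e m x)).
  by apply: continuous_linear_rV => a x y; rewrite lat_is_linear linearP.
by move=> x; exact: (cvg_pair (c1 x) (c2 x)).
Qed.

Let crt7_is_linear a g g' (h h' : 'rV[R]_(7 * m)) :
  crt7 mu q (a *: g + g') (a *: h + h') = a *: crt7 mu q g h + crt7 mu q g' h'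
  :> poly7 R.
Proof.
have lE i : lift7 (a *: h + h') i = a *: lift7 h i + lift7 h' i.
  by rewrite linearP !ffunE.
apply/ffunP => i; rewrite [LHS]ffunE [RHS]ffunE [in RHS]ffunE.
rewrite [crt7 mu q g h i]ffunE [crt7 mu q g' h' i]ffunE lE.
have -> : ((a *: g + g') 0 i - (a *: lift7 h i + lift7 h' i).[mu]) / q.[mu] =
    a * ((g 0 i - (lift7 h i).[mu]) / q.[mu]) + (g' 0 i - (lift7 h' i).[mu]) /
      q.[mu].
  rewrite !mxE hornerD hornerZ; move: (_.[mu]) (_.[mu]) => s t.
  by move: (g 0 i) (g' 0 i) => x y; ring.
by rewrite scalerDl -scalerA addrACA -scalerDr.
Qed.

Let eta_continuous : continuous (@theta_inv R D e mu m q q_size).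
Proof.
have eta_linear a (g g' : 'rV[R]_7) (h h' : 'rV[R]_(7 * m)) :
    @theta_inv R D e mu m q q_size (a *: g + g', a *: h + h') =
    a *: @theta_inv R D e mu m q q_size (g, h) + @theta_inv R D e mu m q q_size
      (g', h').
  by rewrite /theta_inv /= crt7_is_linear linearP scalerDr !scalerA mulrC.
(* Being linear on pairs, the map is a sum of linear maps in each component, which are continuous by
   [continuous_linear_rV]. *)
pose f (g : 'rV[R]_7) : E := @theta_inv R D e mu m q q_size (g, 0).
pose k (h : 'rV[R]_(7 * m)) : E := @theta_inv R D e mu m q q_size (0, h).
have cf : continuous f.
  apply: continuous_linear_rV => a x y.
  by rewrite /f -eta_linear scaler0 addr0.
have ck : continuous k.
  apply: continuous_linear_rV => a x y.
  by rewrite /k -eta_linear scaler0 addr0.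
have -> : @theta_inv R D e mu m q q_size = (fun z => f z.1 + k z.2).
  apply/funext => -[g h]; have := eta_linear 1 g 0 0 h.
  by rewrite !scale1r addr0 add0r.
move=> z; apply: cvgD.
  by apply: (cvg_comp _ _ (@cvg_fst _ _ _ _ _)); exact: cf.
by apply: (cvg_comp _ _ (@cvg_snd _ _ _ _ _)); exact: ck.
Qed.

Lemma scheme_lattice_uniform : uniform_lattice R scheme_lattice.
Proof.
apply: (@triangular_uniform_lattice R (G * H)%type _ (@row_weight m) _ _
  theta_continuous eta_continuous).
- exact: thetaK.
- exact: theta_invK.
- exact: theta0.
- by move=> x x' y y' k; exact: theta_triangular.
- by move=> x y; exact: theta_inv_thetaM_int.
- by move=> x; exact: theta_inv_int.
Qed.

(** Two points with the same image differ, after division by N, by integer polynomials of degree at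
    most m vanishing at mu, which are 0 by minimality of p. *)
Lemma scheme_lattice_injective : {in scheme_lattice &, injective (@fst G H)}.
Proof.
move=> _ _ /set_mem[x xi <-] /set_mem[y yi <-] /= xy; congr theta.
rewrite -[x](@lift7K R m.+1 p p_size) -[y](@lift7K R m.+1 p p_size); congr red7.
apply/ffunP => i; apply/eqP; rewrite -subr_eq0; apply/eqP; apply: p_min.
- have xint z : integral_rV z -> lift7 (m := m.+1) z i \is a polyOver Num.int.
    move=> zi; rewrite ffunE; apply/polyOverP => j; rewrite coef_rVpoly.
    by case: insubP => [k _ _|_]; rewrite ?mxE ?zi// int_num0.
  by apply: int_polyB; exact: xint.
- have /rowP/(_ i) := xy; rewrite !mxE !ffunE !hornerE => /(mulfI N0) ->.
  by rewrite subrr.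
- rewrite p_size; apply: leq_ltn_trans (size_polyD _ _) _.
  by rewrite size_polyN gtn_max !ffunE !ltnS !size_poly.
Qed.

(** Each of the seven residues of h / N is approximated within d / N by [dense_residue]; scaling by
    N then gives a lattice point within d of h. *)
Lemma scheme_lattice_dense : dense (@snd G H @` scheme_lattice).
Proof.
move=> O [h Oh] oO.
have /nbhs_ballP[d /= d0 dO] : nbhs (h : 'rV[R]_(7 * m)) O
  by exact: open_nbhs_nbhs.
have q_coprime a : a \is a polyOver Num.int -> a != 0 -> (size a <= m.+1)%N ->
    coprimep a q.
  move=> ai a0 asz; have := p_coprime ai a0.
  by rewrite p_size ltnS asz coprimepMr => /(_ isT)/andP[].
have N_gt0 : 0 < N by rewrite lt_neqAle eq_sym N0 ler0n.
have dN : 0 < d / N by rewrite divr_gt0.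
have /choice[a aP] (i : 'I_7) : exists a : {poly R}, a \is a polyOver Num.int /\
    forall k, `|((a - N^-1 *: lift7 (m := m) h i) %% q)`_k| < d / N.
  by have [a ai ad] := dense_residue q_size q_monic q_coprime
    (N^-1 *: lift7 (m := m) h i) dN; exists a.
pose u : poly7 R := [ffun i => a i].
pose x : E := red7 m.+1 p u.
have xi : integral_rV x.
  move=> k; case/mxvec_indexP: k => i j; rewrite /x /red7 mxvecE !mxE ffunE.
  by have /polyOverP := modp_int p_monic p_int (aP i).1; exact.
exists (theta D e mu q_size x).2; split; last first.
  by exists (theta D e mu q_size x) => //; exists x.
apply: dO; split => // i0 k; rewrite ord1; case/mxvec_indexP: k => i j.
have -> : (h : 'rV[R]_(7 * m)) 0 (mxvec_index i j) = (lift7 (m := m) h i)`_j.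
  by rewrite ffunE coef_rVpoly_ord !mxE.
have latE : @lat R D e m x i = N *: (a i %% p).
  by rewrite /lat ffunE red7K// ffunE.
rewrite /ball /= /red7 mxvecE !mxE latE.
(* Reduction modulo p does not change the residue modulo q, since q divides p. *)
have -> : (N *: (a i %% p)) %% q = N *: (a i %% q).
  rewrite modpZl; congr (_ *: _).
  by rewrite [in RHS](divp_eq (a i) p) modpD mulrA modp_mull add0r.
have := (aP i).2 j; rewrite modpD modpN modpZl lift7_mod// coefB !coefZ.
rewrite -normrN opprB ltr_pdivlMr// -[X in _ * X]gtr0_norm// -normrM.
by rewrite mulrBl mulrAC mulVf// mul1r [N * _]mulrC.
Qed.

Lemma exists_uniform_model_set : exists P : set G, uniform_model_set R P.
Proof.
pose W0 : set H :=
  [set v : 'rV[R]_(7 * m) | forall i, `[-1, 1]%classic (v 0 i)].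
exists (@fst G H @` (([set: G] `*` W0) `&` scheme_lattice)).
exists H, scheme_lattice, W0; split => //.
- split; [exact: lcsc_Glambda|exact: lcsc_residue_group
  |exact: scheme_lattice_uniform|exact: scheme_lattice_injective
  |exact: scheme_lattice_dense].
- exact: (@compact_box R (7 * m) (-1) 1).
- exists (0 : 'rV[R]_(7 * m)).
  have := @nbhs_box R (7 * m) 0; rewrite /interior /W0.
  by apply: filterS => v vi i; have := vi i; rewrite mxE sub0r add0r.
Qed.

End cut_and_project.

Theorem corollary2p20 (R : realType) (lambda : R)
    (lambda_algebraic : algebraicOver (@ratr R) lambda)
    (lambda_irrational : irrational lambda) :
  (exists P : set (Glambda lambda), uniform_model_set R P) /\
  ~ (exists Gamma : set (Glambda lambda), lattice R Gamma).
Proof.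
split; last by move=> [Gamma latG];
  exact: lambda_irrational (lattice_rational latG).
have [D [p [D_gt0 p_monic p_int p_root p_min]]] :=
  algebraic_integer_multiple lambda_algebraic.
have [q [pq q_monic q_mu]] := minimal_factor p_monic p_root p_min.
have D0 : D%:R != 0 :> R by rewrite pnatr_eq0 -lt0n.
set mu := D%:R * lambda in p_root p_min pq q_mu.
(* The structure constant X / D of the polynomial algebra takes the value lambda at mu, so the first
   factor of the scheme is G_lambda itself. *)
have -> : lambda = D%:R^-1 * mu by rewrite /mu mulKf.
have q_size : size q = (size q).-1.+1
  by rewrite prednK// size_poly_gt0 monic_neq0.
have szp : size (('X - mu%:P) * q) = size p by rewrite -pq size_map_poly.
apply: (@exists_uniform_model_set R D 1440 D_gt0 erefl mu _ q q_size q_mu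
  q_monic).
- rewrite -pq; apply/polyOverP => i; rewrite coef_map /=.
  have /polyOverP/(_ i)/intrP[k ->] := p_int; rewrite ratr_int; exact: intr_int.
- by move=> a ai a_mu; rewrite szp; exact: (minimal_eq0 p_min ai a_mu).
- by move=> a ai a0; rewrite szp -pq;
  exact: (minimal_coprime p_monic p_root p_min ai a0).
Qed.
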